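(* Let $\mathcal C$ be a braided tensor category with braiding $c$ and $\mathcal B$ a tensor category with a tensor functor $\iota:\mathcal C\to\mathcal B$ which extends to a braided functor $(\iota,c'):\overline{\mathcal C}\to\mathcal Z(\mathcal B)$, and with a tensor functor $\mathfrak l:\mathcal B\to\mathcal C$ with tensor structure $\mathfrak l^T$ such that $\mathfrak l\circ\iota=\mathrm{id}$ and $\mathfrak l(c')=c^{-1}$. Let $\mathfrak N$ be an algebra in $\mathcal C$, let $\mathrm{Rep}(\mathfrak N)(\mathcal C)$ be the abelian category of $\mathfrak N$-modules in $\mathcal C$ and $\mathfrak f:\mathrm{Rep}(\mathfrak N)(\mathcal C)\to\mathcal C$ the functor forgetting the $\mathfrak N$-action. Suppose $F:\mathrm{Rep}(\mathfrak N)(\mathcal C)\to\mathcal B$ is an equivalence of abelian categories together with a natural isomorphism $\eta_\bullet:\mathfrak l\circ F\to\mathfrak f$. Regard both categories as right $\mathcal C$-module categories: for $N\in\mathcal B$, $V\in\mathcal C$ put $N.V=N\otimes_{\mathcal B}\iota(V)$; for $M\in\mathrm{Rep}(\mathfrak N)(\mathcal C)$, $V\in\mathcal C$ let $M.V$ be the object $\mathfrak f(M)\otimes_{\mathcal C}V$ with $\mathfrak N$ acting on the first factor only. Suppose that $F$ has the additional structure of an equivalence of $\mathcal C$-module categories $$F^T:\ F(M.V)\xrightarrow{\ \sim\ }F(M)\otimes_{\mathcal B}\iota(V)$$ for all $M\in\mathrm{Rep}(\mathfrak N)(\mathcal C)$, $V\in\mathcal C$, and that its image under $\mathfrak l$ is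 trivial in the sense that $$(\eta_M\otimes\mathrm{id}_V)\circ\mathfrak l^T\circ\mathfrak l(F^T)=\mathfrak f^T\circ\eta_{M.V}\ :\ \mathfrak l(F(M.V))\to\mathfrak f(M)\otimes_{\mathcal C}V .$$ Then $\mathfrak N$ has the structure of a bialgebra in the braided tensor category $\mathcal C$ such that $F$ is an equivalence of tensor categories. If moreover $\mathcal B$ and $\mathcal C$ are rigid and $\iota$ and $\mathfrak l$ are functors between rigid tensor categories, then $\mathfrak N$ has the structure of a Hopf algebra such that $F$ is an equivalence of rigid tensor categories.
   Context: $\overline{\mathcal C}$ is $\mathcal C$ with reversed braiding. $\mathcal Z(\mathcal B)$ is the Drinfeld center: objects $(Z,\gamma)$ with half-braidings $\gamma_N:N\otimes Z\to Z\otimes N$. So $c'$ provides half-braidings $N\otimes\iota(V)\to\iota(V)\otimes N$ for $V\in\mathcal C$, $N\in\mathcal B$, and $\mathfrak l(c')=c^{-1}$ means that under $\mathfrak l$ (using $\mathfrak l^T$) they become $c^{-1}_{V,\mathfrak l(N)}:\mathfrak l(N)\otimes V\to V\otimes\mathfrak l(N)$. $\mathfrak f^T:\mathfrak f(M.V)\to\mathfrak f(M)\otimes_{\mathcal C}V$ is the canonical identification. A bialgebra in $\mathcal C$ is an algebra and coalgebra $\mathfrak N$ in $\mathcal C$ with $\Delta\circ m=(m\otimes m)(\mathrm{id}\otimes c_{\mathfrak N,\mathfrak N}\otimes\mathrm{id})(\Delta\otimes\Delta)$, $\Delta\circ u=u\otimes u$, $\epsilon\circ m=\epsilon\otimes\epsilon$,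 $\epsilon\circ u=\mathrm{id}$; it is a Hopf algebra if it has an antipode (assumed bijective). For a bialgebra, $\mathrm{Rep}(\mathfrak N)(\mathcal C)$ is a tensor category with $X\otimes Y$ the tensor product in $\mathcal C$ and action $(m_X\otimes m_Y)(\mathrm{id}\otimes c_{\mathfrak N,X}\otimes\mathrm{id})(\Delta\otimes\mathrm{id}_X\otimes\mathrm{id}_Y)$ (associators suppressed); the unit has action $\epsilon$.
   Formalization: Half-braidings are taken as Z⊗N→N⊗Z, so l(c')=c^{-1} means c^{-1}_{l(N),V}: V⊗l(N)→l(N)⊗V; with the direction N⊗Z→Z⊗N and c^{-1}_{V,l(N)} the claim is false (it yields a bialgebra in the reversed category, e.g. k[x] in Z-graded spaces with braiding q^{ab}, q²≠1). *)

(* Defs.v *)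
From HB Require Import structures.
From mathcomp Require Import ssreflect ssrfun ssrbool eqtype choice ssralg.
From mathcomp Require Import boolp.

Set Implicit Arguments.
Unset Strict Implicit.
Unset Printing Implicit Defensive.

Import GRing.Theory.

Declare Scope cat_scope.
Delimit Scope cat_scope with cat.
Local Open Scope ring_scope.
Local Open Scope cat_scope.

Reserved Notation "g ∘ f" (at level 40, left associativity).
Reserved Notation "X ⊗ Y" (at level 35, right associativity).
Reserved Notation "f ⊠ g" (at level 35, right associativity).

Record preadditive := Preadditive {
  obj :> Type;
  hom : obj -> obj -> zmodType;
  idm : forall X, hom X X;
  comp : forall X Y Z, hom Y Z -> hom X Y -> hom X Z;
  compA : forall W X Y Z (h : hom Y Z) (g : hom X Y) (f : hom W X),
    comp h (comp g f) = comp (comp h g) f;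
  comp1m : forall X Y (f : hom X Y), comp (idm Y) f = f;
  compm1 : forall X Y (f : hom X Y), comp f (idm X) = f;
  compDl : forall X Y Z (g h : hom Y Z) (f : hom X Y),
    comp (g + h) f = comp g f + comp h f;
  compDr : forall X Y Z (h : hom Y Z) (f g : hom X Y),
    comp h (f + g) = comp h f + comp h g
}.
Arguments idm {p} X.
Notation "g ∘ f" := (comp g f) : cat_scope.

Record iso (C : preadditive) (X Y : C) := Iso {
  fwd : hom X Y;
  bwd : hom Y X;
  fwdK : bwd ∘ fwd = idm X;
  bwdK : fwd ∘ bwd = idm Y
}.

Definition iso_id (C : preadditive) (X : C) : iso X X :=
  Iso (comp1m (idm X)) (comp1m (idm X)).

Definition iso_inv (C : preadditive) (X Y : C) (i : iso X Y) : iso Y X :=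
  Iso (bwdK i) (fwdK i).

Lemma iso_comp_subproof (C : preadditive) (X Y Z : C) (j : iso Y Z) (i : iso X Y) :
  (bwd i ∘ bwd j) ∘ (fwd j ∘ fwd i) = idm X.
Proof. by rewrite compA -(compA _ (bwd j)) fwdK compm1 fwdK. Qed.

Lemma iso_comp_subproof' (C : preadditive) (X Y Z : C) (j : iso Y Z) (i : iso X Y) :
  (fwd j ∘ fwd i) ∘ (bwd i ∘ bwd j) = idm Z.
Proof. exact: (iso_comp_subproof (iso_inv i) (iso_inv j)). Qed.

Definition iso_comp (C : preadditive) (X Y Z : C) (j : iso Y Z) (i : iso X Y) :
  iso X Z := Iso (iso_comp_subproof j i) (iso_comp_subproof' j i).

Section CompLemmas.
Variable C : preadditive.

Lemma fwd_inj (W X Y : C) (i : iso X Y) (f g : hom W X) :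
  fwd i ∘ f = fwd i ∘ g -> f = g.
Proof.
by move=> /(congr1 (fun h => bwd i ∘ h)); rewrite !compA fwdK !comp1m.
Qed.
Lemma fwd_injr (X Y Z : C) (i : iso X Y) (f g : hom Y Z) :
  f ∘ fwd i = g ∘ fwd i -> f = g.
Proof.
by move=> /(congr1 (fun h => h ∘ bwd i)); rewrite -!compA bwdK !compm1.
Qed.

Lemma pre2 (X Y Z W : C) (a : hom Y Z) (b : hom X Y) (r : hom X Z) :
  a ∘ b = r -> forall x : hom Z W, x ∘ a ∘ b = x ∘ r.
Proof. by move=> <- x; rewrite compA. Qed.
Lemma pre3 (X Y Y' Z W : C) (a : hom Y' Z) (b : hom Y Y') (c : hom X Y)
    (r : hom X Z) :
  a ∘ b ∘ c = r -> forall x : hom Z W, x ∘ a ∘ b ∘ c = x ∘ r.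
Proof. by move=> <- x; rewrite !compA. Qed.

Lemma comp0m (X Y Z : C) (f : hom X Y) : (0 : hom Y Z) ∘ f = 0.
Proof. by apply: (addrI (0 ∘ f)); rewrite -compDl !addr0. Qed.
Lemma compm0 (X Y Z : C) (f : hom Y Z) : f ∘ (0 : hom X Y) = 0.
Proof. by apply: (addrI (f ∘ 0)); rewrite -compDr !addr0. Qed.
Lemma compNm (X Y Z : C) (g : hom Y Z) (f : hom X Y) : (- g) ∘ f = - (g ∘ f).
Proof. by apply: (addrI (g ∘ f)); rewrite -compDl !subrr comp0m. Qed.
Lemma compmN (X Y Z : C) (g : hom Y Z) (f : hom X Y) : g ∘ (- f) = - (g ∘ f).
Proof. by apply: (addrI (g ∘ f)); rewrite -compDr !subrr compm0. Qed.

End CompLemmas.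

Section Abelian.
Variable C : preadditive.

Definition mono (X Y : C) (f : hom X Y) : Prop :=
  forall W (g h : hom W X), f ∘ g = f ∘ h -> g = h.

Definition epi (X Y : C) (f : hom X Y) : Prop :=
  forall Z (g h : hom Y Z), g ∘ f = h ∘ f -> g = h.

Definition is_kernel (K X Y : C) (k : hom K X) (f : hom X Y) : Prop :=
  f ∘ k = 0 /\
  forall W (g : hom W X), f ∘ g = 0 -> exists! h : hom W K, k ∘ h = g.

Definition is_cokernel (X Y Q : C) (q : hom Y Q) (f : hom X Y) : Prop :=
  q ∘ f = 0 /\
  forall Z (g : hom Y Z), g ∘ f = 0 -> exists! h : hom Q Z, h ∘ q = g.

Definition is_zero_object (Z : C) : Prop := idm Z = 0.

Definition is_biproduct (X Y S : C) (i1 : hom X S) (i2 : hom Y S)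
    (p1 : hom S X) (p2 : hom S Y) : Prop :=
  [/\ p1 ∘ i1 = idm X, p2 ∘ i2 = idm Y, p2 ∘ i1 = 0, p1 ∘ i2 = 0
    & i1 ∘ p1 + i2 ∘ p2 = idm S].

Record abelian : Prop := Abelian {
  ab_zero : exists Z : C, is_zero_object Z;
  ab_biproduct : forall X Y : C, exists S (i1 : hom X S) (i2 : hom Y S)
    (p1 : hom S X) (p2 : hom S Y), is_biproduct i1 i2 p1 p2;
  ab_kernel : forall (X Y : C) (f : hom X Y),
    exists K (k : hom K X), is_kernel k f;
  ab_cokernel : forall (X Y : C) (f : hom X Y),
    exists Q (q : hom Y Q), is_cokernel q f;
  ab_mono : forall (X Y : C) (f : hom X Y),
    mono f -> exists Z (g : hom Y Z), is_kernel f g;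
  ab_epi : forall (X Y : C) (f : hom X Y),
    epi f -> exists W (g : hom W X), is_cokernel f g
}.

End Abelian.

Record functor (C D : preadditive) := Functor {
  fob :> C -> D;
  fmap : forall X Y : C, hom X Y -> hom (fob X) (fob Y);
  fmap1 : forall X, fmap (idm X) = idm (fob X);
  fmapM : forall (X Y Z : C) (g : hom Y Z) (f : hom X Y),
    fmap (g ∘ f) = fmap g ∘ fmap f;
  fmapD : forall (X Y : C) (f g : hom X Y), fmap (f + g) = fmap f + fmap g
}.
Arguments fmap {C D} F {X Y} f : rename.

Definition functor_id (C : preadditive) : functor C C :=
  @Functor C C (fun X => X) (fun X Y f => f) (fun X => erefl)
    (fun X Y Z g f => erefl) (fun X Y f g => erefl).

Section FunctorComp.
Variables (C D E : preadditive) (G : functor D E) (F : functor C D).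
Lemma fcomp1 (X : C) : fmap G (fmap F (idm X)) = idm (G (F X)).
Proof. by rewrite !fmap1. Qed.
Lemma fcompM (X Y Z : C) (g : hom Y Z) (f : hom X Y) :
  fmap G (fmap F (g ∘ f)) = fmap G (fmap F g) ∘ fmap G (fmap F f).
Proof. by rewrite !fmapM. Qed.
Lemma fcompD (X Y : C) (f g : hom X Y) :
  fmap G (fmap F (f + g)) = fmap G (fmap F f) + fmap G (fmap F g).
Proof. by rewrite !fmapD. Qed.
Definition functor_comp : functor C E :=
  @Functor C E (fun X => G (F X)) (fun X Y f => fmap G (fmap F f))
    fcomp1 fcompM fcompD.
End FunctorComp.

Section FmapIso.
Variables (C D : preadditive) (F : functor C D) (X Y : C) (i : iso X Y).
Lemma fmap_isoK : fmap F (bwd i) ∘ fmap F (fwd i) = idm (F X).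
Proof. by rewrite -fmapM fwdK fmap1. Qed.
Lemma fmap_isoK' : fmap F (fwd i) ∘ fmap F (bwd i) = idm (F Y).
Proof. by rewrite -fmapM bwdK fmap1. Qed.
Definition fmap_iso : iso (F X) (F Y) := Iso fmap_isoK fmap_isoK'.
End FmapIso.

Record natiso (C D : preadditive) (F G : functor C D) := NatIso {
  nat_iso :> forall X : C, iso (F X) (G X);
  nat_isoE : forall (X Y : C) (f : hom X Y),
    fwd (nat_iso Y) ∘ fmap F f = fmap G f ∘ fwd (nat_iso X)
}.

(* An additive functor with an additive quasi-inverse; between abelian
   categories such a functor is automatically exact. *)
Definition is_equivalence (C D : preadditive) (F : functor C D) : Prop :=
  exists G : functor D C,
    inhabited (natiso (functor_comp G F) (functor_id C)) /\
    inhabited (natiso (functor_comp F G) (functor_id D)).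

Record moncat := Moncat {
  mc_cat :> preadditive;
  tens : mc_cat -> mc_cat -> mc_cat;
  tensm : forall X X' Y Y' : mc_cat,
    hom X X' -> hom Y Y' -> hom (tens X Y) (tens X' Y');
  munit : mc_cat;
  assoc : forall X Y Z, iso (tens (tens X Y) Z) (tens X (tens Y Z));
  lunit : forall X, iso (tens munit X) X;
  runit : forall X, iso (tens X munit) X;
  tensm1 : forall X Y, tensm (idm X) (idm Y) = idm (tens X Y);
  tensmM : forall (X X' X'' Y Y' Y'' : mc_cat) (f' : hom X' X'')
      (f : hom X X') (g' : hom Y' Y'') (g : hom Y Y'),
    tensm (f' ∘ f) (g' ∘ g) = tensm f' g' ∘ tensm f g;
  tensmDl : forall (X X' Y Y' : mc_cat) (f f' : hom X X') (g : hom Y Y'),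
    tensm (f + f') g = tensm f g + tensm f' g;
  tensmDr : forall (X X' Y Y' : mc_cat) (f : hom X X') (g g' : hom Y Y'),
    tensm f (g + g') = tensm f g + tensm f g';
  assoc_nat : forall (X X' Y Y' Z Z' : mc_cat) (f : hom X X') (g : hom Y Y')
      (h : hom Z Z'),
    fwd (assoc X' Y' Z') ∘ tensm (tensm f g) h =
    tensm f (tensm g h) ∘ fwd (assoc X Y Z);
  lunit_nat : forall (X Y : mc_cat) (f : hom X Y),
    fwd (lunit Y) ∘ tensm (idm munit) f = f ∘ fwd (lunit X);
  runit_nat : forall (X Y : mc_cat) (f : hom X Y),
    fwd (runit Y) ∘ tensm f (idm munit) = f ∘ fwd (runit X);
  pentagon : forall W X Y Z,
    fwd (assoc W X (tens Y Z)) ∘ fwd (assoc (tens W X) Y Z) =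
    tensm (idm W) (fwd (assoc X Y Z)) ∘ fwd (assoc W (tens X Y) Z)
      ∘ tensm (fwd (assoc W X Y)) (idm Z);
  triangle : forall X Y,
    tensm (idm X) (fwd (lunit Y)) ∘ fwd (assoc X munit Y) =
    tensm (fwd (runit X)) (idm Y)
}.
Notation "X ⊗ Y" := (tens X Y) : cat_scope.
Notation "f ⊠ g" := (tensm f g) : cat_scope.
Arguments munit {m}.

(* An abelian category with a biadditive monoidal structure that is right
   exact in each variable; duals are not required.  Right exactness is what
   makes the categories of modules over algebras abelian. *)
Record tensorcat := TensorCat {
  tc_mc :> moncat;
  tc_ab : abelian tc_mc;
  tc_rexactl : forall (W X Y Q : tc_mc) (q : hom Y Q) (f : hom X Y),
    is_cokernel q f -> is_cokernel (idm W ⊠ q) (idm W ⊠ f);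
  tc_rexactr : forall (W X Y Q : tc_mc) (q : hom Y Q) (f : hom X Y),
    is_cokernel q f -> is_cokernel (q ⊠ idm W) (f ⊠ idm W)
}.

Section MonoidalLemmas.
Variable C : moncat.

Lemma tens_isoK (X X' Y Y' : C) (i : iso X X') (j : iso Y Y') :
  (bwd i ⊠ bwd j) ∘ (fwd i ⊠ fwd j) = idm (X ⊗ Y).
Proof. by rewrite -tensmM !fwdK tensm1. Qed.
Definition tens_iso (X X' Y Y' : C) (i : iso X X') (j : iso Y Y') :
    iso (X ⊗ Y) (X' ⊗ Y') :=
  Iso (tens_isoK i j) (tens_isoK (iso_inv i) (iso_inv j)).

Lemma tens1M (X Y Y' Y'' : C) (g' : hom Y' Y'') (g : hom Y Y') :
  idm X ⊠ (g' ∘ g) = (idm X ⊠ g') ∘ (idm X ⊠ g).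
Proof. by rewrite -tensmM comp1m. Qed.
Lemma tensM1 (X Y Y' Y'' : C) (g' : hom Y' Y'') (g : hom Y Y') :
  (g' ∘ g) ⊠ idm X = (g' ⊠ idm X) ∘ (g ⊠ idm X).
Proof. by rewrite -tensmM comp1m. Qed.
Lemma tens_swap (X X' Y Y' : C) (f : hom X X') (g : hom Y Y') :
  (f ⊠ idm Y') ∘ (idm X ⊠ g) = (idm X' ⊠ g) ∘ (f ⊠ idm Y).
Proof. by rewrite -!tensmM !comp1m !compm1. Qed.
Lemma tens_lr (X X' Y Y' : C) (f : hom X X') (g : hom Y Y') :
  f ⊠ g = (f ⊠ idm Y') ∘ (idm X ⊠ g).
Proof. by rewrite -tensmM comp1m compm1. Qed.

Lemma tens1_inj (X Y : C) (f g : hom X Y) :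
  idm (@munit C) ⊠ f = idm munit ⊠ g -> f = g.
Proof.
move=> /(congr1 (fun h => fwd (lunit Y) ∘ h)).
by rewrite !lunit_nat => /fwd_injr.
Qed.
Lemma tensm1_inj (X Y : C) (f g : hom X Y) :
  f ⊠ idm (@munit C) = g ⊠ idm munit -> f = g.
Proof.
move=> /(congr1 (fun h => fwd (runit Y) ∘ h)).
by rewrite !runit_nat => /fwd_injr.
Qed.

Lemma lunit_tens (X Y : C) :
  fwd (lunit (X ⊗ Y)) ∘ fwd (assoc munit X Y) = fwd (lunit X) ⊠ idm Y.
Proof.
apply: tens1_inj.
apply: (fwd_injr (i := assoc munit (munit ⊗ X) Y)).
apply: (fwd_injr (i := tens_iso (assoc munit munit X) (iso_id Y))) => /=.
rewrite tens1M ?compA (pre3 (esym (pentagon _ _ _ _))) ?compA triangle.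
by rewrite -assoc_nat -compA -tensM1 triangle -tensm1 assoc_nat.
Qed.

Lemma tensm0 (W X Y Z : C) (f : hom W X) : f ⊠ (0 : hom Y Z) = 0.
Proof. by apply: (addrI (f ⊠ 0)); rewrite -tensmDr !addr0. Qed.
Lemma tens0m (W X Y Z : C) (f : hom W X) : (0 : hom Y Z) ⊠ f = 0.
Proof. by apply: (addrI (0 ⊠ f)); rewrite -tensmDl !addr0. Qed.
Lemma tensmN (W X Y Z : C) (f : hom W X) (g : hom Y Z) : f ⊠ (- g) = - (f ⊠ g).
Proof. by apply: (addrI (f ⊠ g)); rewrite -tensmDr !subrr tensm0. Qed.
Lemma tensNm (W X Y Z : C) (f : hom W X) (g : hom Y Z) : (- g) ⊠ f = - (g ⊠ f).
Proof. by apply: (addrI (g ⊠ f)); rewrite -tensmDl !subrr tens0m. Qed.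

End MonoidalLemmas.

(* A morphism between bracketed words of objects is compared with one between
   words that are bracketed to the right and end in a variable object [t];
   all associators and unitors become identities. *)
Section Flatten.
Variable C : moncat.

Inductive word := WO of C | WI | WT of word & word.

Fixpoint wden (e : word) : C :=
  match e with WO X => X | WI => munit | WT a b => wden a ⊗ wden b end.

Fixpoint flat (e : word) (t : C) : C :=
  match e with WO X => X ⊗ t | WI => t | WT a b => flat a (flat b t) end.

Fixpoint flatf (e : word) (t t' : C) (g : hom t t') :
    hom (flat e t) (flat e t') :=
  match e with
  | WO X => idm X ⊠ g
  | WI => g
  | WT a b => flatf a (flatf b g)
  end.

Fixpoint flati (e : word) (t : C) : iso (wden e ⊗ t) (flat e t) :=
  match e with
  | WO X => iso_id (X ⊗ t)
  | WI => lunit t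
  | WT a b => iso_comp (flati a (flat b t))
       (iso_comp (tens_iso (iso_id (wden a)) (flati b t))
                 (assoc (wden a) (wden b) t))
  end.

Definition gen_def (a b : word) (f : hom (wden a) (wden b)) (t : C) :
    hom (flat a t) (flat b t) :=
  fwd (flati b t) ∘ (f ⊠ idm t) ∘ bwd (flati a t).
Fact gen_key : unit. Proof. exact: tt. Qed.
(* Locked, so that rewriting with [compA] does not unfold it. *)
Definition gen := locked_with gen_key gen_def.
Lemma genE (a b : word) (f : hom (wden a) (wden b)) (t : C) :
  gen f t = fwd (flati b t) ∘ (f ⊠ idm t) ∘ bwd (flati a t).
Proof. by rewrite /gen locked_withE. Qed.

Inductive mor : word -> word -> Type :=
  | MId a : mor a a
  | MComp a b c of mor b c & mor a b : mor a c
  | MTens a a' b b' of mor a a' & mor b b' : mor (WT a b) (WT a' b')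
  | MA a b c : mor (WT (WT a b) c) (WT a (WT b c))
  | MA' a b c : mor (WT a (WT b c)) (WT (WT a b) c)
  | ML a : mor (WT WI a) a
  | ML' a : mor a (WT WI a)
  | MR a : mor (WT a WI) a
  | MR' a : mor a (WT a WI)
  | MGen a b of hom (wden a) (wden b) : mor a b.

Fixpoint mden a b (m : mor a b) : hom (wden a) (wden b) :=
  match m in mor a b return hom (wden a) (wden b) with
  | MId a => idm (wden a)
  | MComp _ _ _ g f => mden g ∘ mden f
  | MTens _ _ _ _ f g => mden f ⊠ mden g
  | MA a b c => fwd (assoc (wden a) (wden b) (wden c))
  | MA' a b c => bwd (assoc (wden a) (wden b) (wden c))
  | ML a => fwd (lunit (wden a))
  | ML' a => bwd (lunit (wden a))
  | MR a => fwd (runit (wden a))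
  | MR' a => bwd (runit (wden a))
  | MGen _ _ f => f
  end.

Fixpoint flatm a b (m : mor a b) (t : C) : hom (flat a t) (flat b t) :=
  match m in mor a b return hom (flat a t) (flat b t) with
  | MId a => idm (flat a t)
  | MComp _ _ _ g f => flatm g t ∘ flatm f t
  | MTens a _ _ b' f g => flatm f (flat b' t) ∘ flatf a (flatm g t)
  | MA a b c => idm (flat a (flat b (flat c t)))
  | MA' a b c => idm (flat a (flat b (flat c t)))
  | ML a => idm (flat a t)
  | ML' a => idm (flat a t)
  | MR a => idm (flat a t)
  | MR' a => idm (flat a t)
  | MGen _ _ f => gen f t
  end.

Lemma flatf1 e t : flatf e (idm t) = idm (flat e t).
Proof.
by elim: e t => [X|//|a IHa b IHb] t /=; rewrite ?tensm1 ?IHb ?IHa.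
Qed.

Lemma flatfM e t t' t'' (g : hom t' t'') (f : hom t t') :
  flatf e (g ∘ f) = flatf e g ∘ flatf e f.
Proof.
elim: e t t' t'' g f => [X|//|a IHa b IHb] t t' t'' g f /=.
- exact: tens1M.
- by rewrite IHb IHa.
Qed.

Lemma flati_nat e t t' (g : hom t t') :
  fwd (flati e t') ∘ (idm (wden e) ⊠ g) = flatf e g ∘ fwd (flati e t).
Proof.
elim: e t t' g => [X|//|a IHa b IHb] t t' g /=.
- by rewrite comp1m compm1.
- exact: lunit_nat.
- rewrite -tensm1 -!compA assoc_nat [X in _ ∘ X]compA -tens1M IHb tens1M.
  by rewrite ?compA IHa.
Qed.

Lemma gen_nat a b (f : hom (wden a) (wden b)) t t' (g : hom t t') :
  gen f t' ∘ flatf a g = flatf b g ∘ gen f t.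
Proof.
rewrite !genE; apply: (fwd_injr (i := flati a t)).
rewrite -!compA fwdK compm1 -flati_nat.
rewrite [bwd _ ∘ (_ ∘ _)]compA fwdK comp1m tens_swap.
by rewrite compA flati_nat compA.
Qed.

Lemma flatm_nat a b (m : mor a b) t t' (g : hom t t') :
  flatm m t' ∘ flatf a g = flatf b g ∘ flatm m t.
Proof.
elim: m t t' g => //=.
- by move=> *; rewrite comp1m compm1.
- by move=> ? ? ? ? IH1 ? IH2 t t' g; rewrite -compA IH2 compA IH1 compA.
- move=> ? ? ? ? ? IH1 ? IH2 t t' g.
  by rewrite -compA -flatfM IH2 compA -IH1 flatfM compA.
all: try by move=> *; rewrite comp1m compm1.
by move=> *; exact: gen_nat.
Qed.

Lemma flatm_den a b (m : mor a b) t :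
  fwd (flati b t) ∘ (mden m ⊠ idm t) = flatm m t ∘ fwd (flati a t).
Proof.
have pent (x y z : word) s : fwd (flati (WT x (WT y z)) s) ∘
    (fwd (assoc (wden x) (wden y) (wden z)) ⊠ idm s) =
    fwd (flati (WT (WT x y) z) s).
  rewrite /= !tens1M ?compA (pre3 (esym (pentagon _ _ _ _))) ?compA.
  congr (_ ∘ _); rewrite -[LHS]compA -assoc_nat ?compA tensm1.
  by [].
have unl (x : word) s : fwd (flati x s) ∘ (fwd (lunit (wden x)) ⊠ idm s) =
    fwd (flati (WT WI x) s).
  by rewrite /= compA lunit_nat -lunit_tens compA.
have unr (x : word) s : fwd (flati x s) ∘ (fwd (runit (wden x)) ⊠ idm s) =
    fwd (flati (WT x WI) s).
  by rewrite /= triangle.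
have bw (x y : word) (i : iso (wden x) (wden y)) s :
    (fwd i ⊠ idm s) ∘ (bwd i ⊠ idm s) = idm _.
  by rewrite -tensM1 bwdK tensm1.
elim: m t => /=.
- by move=> *; rewrite tensm1 comp1m compm1.
- by move=> ? ? ? ? IH1 ? IH2 t; rewrite tensM1 compA IH1 -compA IH2 compA.
- move=> a0 a' b0 b' f IHf g IHg t.
  have E : (idm _ ⊠ fwd (flati b' t)) ∘ (mden f ⊠ (mden g ⊠ idm t)) =
     (mden f ⊠ idm _) ∘ (idm _ ⊠ flatm g t) ∘ (idm _ ⊠ fwd (flati b0 t)).
    by rewrite -!tensmM !comp1m !compm1 IHg.
  rewrite ?compA (pre2 (assoc_nat _ _ _)) ?compA (pre2 E) ?compA IHf.
  by rewrite (pre2 (flati_nat _ _)) ?compA.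
- by move=> x y z t; rewrite comp1m; exact: pent.
- move=> x y z t; rewrite comp1m -[LHS]/(fwd (flati (WT (WT x y) z) t) ∘ _).
  by rewrite -pent -compA (bw (WT (WT x y) z) (WT x (WT y z))) compm1.
- by move=> x t; rewrite comp1m unl.
- by move=> x t; rewrite comp1m -[LHS]/(fwd (flati (WT WI x) t) ∘ _) -unl
    -compA (bw (WT WI x) x) compm1.
- by move=> x t; rewrite comp1m unr.
- by move=> x t; rewrite comp1m -[LHS]/(fwd (flati (WT x WI) t) ∘ _) -unr
    -compA (bw (WT x WI) x) compm1.
- by move=> x y f t; rewrite genE -compA fwdK compm1.
Qed.

Lemma flatm_inj a b (m m' : mor a b) :
  (forall t, flatm m t = flatm m' t) -> mden m = mden m'.
Proof.
move=> E; apply: tensm1_inj; apply: (fwd_inj (i := flati b munit)).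
by rewrite !flatm_den E.
Qed.

Lemma flatm_eq a b (m m' : mor a b) t :
  mden m = mden m' -> flatm m t = flatm m' t.
Proof.
move=> E; apply: (fwd_injr (i := flati a t)).
by rewrite -!flatm_den E.
Qed.

Lemma gen1 a t : gen (b := a) (idm (wden a)) t = idm (flat a t).
Proof. by rewrite genE tensm1 compm1 bwdK. Qed.

End Flatten.

Arguments flati : simpl never.

Ltac rword C X :=
  lazymatch X with
  | @tens _ ?A ?B =>
      let a := rword C A in let b := rword C B in constr:(@WT C a b)
  | @munit _ => constr:(@WI C)
  | _ => constr:(@WO C X)
  end.

Ltac rmor C f :=
  lazymatch f with
  | @idm _ ?X => let a := rword C X in constr:(@MId C a)
  | @comp _ _ _ _ ?g ?h =>
      let m := rmor C g in let n := rmor C h in constr:(MComp m n)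
  | @tensm _ _ _ _ _ ?g ?h =>
      let m := rmor C g in let n := rmor C h in constr:(MTens m n)
  | fwd (assoc ?X ?Y ?Z) =>
      let a := rword C X in let b := rword C Y in let c := rword C Z in
      constr:(MA a b c)
  | bwd (assoc ?X ?Y ?Z) =>
      let a := rword C X in let b := rword C Y in let c := rword C Z in
      constr:(MA' a b c)
  | fwd (lunit ?X) => let a := rword C X in constr:(ML a)
  | bwd (lunit ?X) => let a := rword C X in constr:(ML' a)
  | fwd (runit ?X) => let a := rword C X in constr:(MR a)
  | bwd (runit ?X) => let a := rword C X in constr:(MR' a)
  | _ => lazymatch type of f with
    | context [@hom _ ?X ?Y] =>
      let a := rword C X in let b := rword C Y in constr:(@MGen C a b f)
    end
  end.

(* Passes from an equation between morphisms of a monoidal category to the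
   equation between their flattenings. *)
Ltac flatten_in C H t :=
  lazymatch type of H with
  | @eq _ ?f ?g =>
    let m := rmor C f in let n := rmor C g in
    let H' := fresh in
    have H' := @flatm_eq C _ _ m n t H;
    move: H'; rewrite /= ?flatf1 ?tensm1 ?comp1m ?compm1 ?compA
  end.

Ltac flatten C :=
  lazymatch goal with
  | |- @eq _ ?f ?g =>
    let m := rmor C f in let n := rmor C g in
    apply: (@flatm_inj C _ _ m n);
    let t := fresh "t" in
    move=> t; rewrite /= ?flatf1 ?tensm1 ?comp1m ?compm1 ?compA
  end.

Record braiding (C : moncat) := Braiding {
  br :> forall X Y : C, iso (X ⊗ Y) (Y ⊗ X);
  br_nat : forall (X X' Y Y' : C) (f : hom X X') (g : hom Y Y'),
    fwd (br X' Y') ∘ (f ⊠ g) = (g ⊠ f) ∘ fwd (br X Y);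
  br_hex1 : forall X Y Z : C,
    fwd (assoc Y Z X) ∘ fwd (br X (Y ⊗ Z)) ∘ fwd (assoc X Y Z) =
    (idm Y ⊠ fwd (br X Z)) ∘ fwd (assoc Y X Z) ∘ (fwd (br X Y) ⊠ idm Z);
  br_hex2 : forall X Y Z : C,
    bwd (assoc Z X Y) ∘ fwd (br (X ⊗ Y) Z) ∘ bwd (assoc X Y Z) =
    (fwd (br X Z) ⊠ idm Y) ∘ bwd (assoc X Z Y) ∘ (idm X ⊠ fwd (br Y Z))
}.

Lemma iso_eq (C : preadditive) (X Y : C) (i j : iso X Y) :
  bwd i = bwd j -> fwd i = fwd j.
Proof.
by move=> E; apply: (fwd_injr (i := iso_inv i)); rewrite /= bwdK E bwdK.
Qed.

Section Reverse.
Variables (C : moncat) (c : braiding C).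

Definition rev_br (X Y : C) : iso (X ⊗ Y) (Y ⊗ X) := iso_inv (c Y X).

Lemma rev_nat (X X' Y Y' : C) (f : hom X X') (g : hom Y Y') :
  fwd (rev_br X' Y') ∘ (f ⊠ g) = (g ⊠ f) ∘ fwd (rev_br X Y).
Proof.
rewrite /=; apply: (fwd_inj (i := c Y' X')).
rewrite !compA bwdK comp1m br_nat -compA bwdK compm1 //.
Qed.

Lemma rev_hex1 (X Y Z : C) :
  fwd (assoc Y Z X) ∘ fwd (rev_br X (Y ⊗ Z)) ∘ fwd (assoc X Y Z) =
  (idm Y ⊠ fwd (rev_br X Z)) ∘ fwd (assoc Y X Z) ∘ (fwd (rev_br X Y) ⊠ idm Z).
Proof.
apply: (@iso_eq _ _ _
  (iso_comp (iso_comp (assoc Y Z X) (rev_br X (Y ⊗ Z))) (assoc X Y Z))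
  (iso_comp (iso_comp (tens_iso (iso_id Y) (rev_br X Z)) (assoc Y X Z))
     (tens_iso (rev_br X Y) (iso_id Z)))) => /=.
by rewrite !compA br_hex2.
Qed.

Lemma rev_hex2 (X Y Z : C) :
  bwd (assoc Z X Y) ∘ fwd (rev_br (X ⊗ Y) Z) ∘ bwd (assoc X Y Z) =
  (fwd (rev_br X Z) ⊠ idm Y) ∘ bwd (assoc X Z Y) ∘ (idm X ⊠ fwd (rev_br Y Z)).
Proof.
apply: (@iso_eq _ _ _
  (iso_comp (iso_comp (iso_inv (assoc Z X Y)) (rev_br (X ⊗ Y) Z))
     (iso_inv (assoc X Y Z)))
  (iso_comp (iso_comp (tens_iso (rev_br X Z) (iso_id Y))
     (iso_inv (assoc X Z Y))) (tens_iso (iso_id X) (rev_br Y Z)))) => /=.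
by rewrite !compA br_hex1.
Qed.

Definition rev_braiding : braiding C :=
  @Braiding C rev_br rev_nat rev_hex1 rev_hex2.

End Reverse.

Record monoidal (C D : moncat) (F : functor C D) := Monoidal {
  mf_T : forall X Y : C, iso (F (X ⊗ Y)) (F X ⊗ F Y);
  mf_U : iso (F munit) munit;
  mf_T_nat : forall (X X' Y Y' : C) (f : hom X X') (g : hom Y Y'),
    fwd (mf_T X' Y') ∘ fmap F (f ⊠ g) =
    (fmap F f ⊠ fmap F g) ∘ fwd (mf_T X Y);
  mf_assoc : forall X Y Z : C,
    fwd (assoc (F X) (F Y) (F Z)) ∘ (fwd (mf_T X Y) ⊠ idm (F Z))
      ∘ fwd (mf_T (X ⊗ Y) Z) =
    (idm (F X) ⊠ fwd (mf_T Y Z)) ∘ fwd (mf_T X (Y ⊗ Z))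
      ∘ fmap F (fwd (assoc X Y Z));
  mf_lunit : forall X : C,
    fwd (lunit (F X)) ∘ (fwd mf_U ⊠ idm (F X)) ∘ fwd (mf_T munit X) =
    fmap F (fwd (lunit X));
  mf_runit : forall X : C,
    fwd (runit (F X)) ∘ (idm (F X) ⊠ fwd mf_U) ∘ fwd (mf_T X munit) =
    fmap F (fwd (runit X))
}.

(* A tensor functor between tensor categories is an additive functor with a
   (strong) monoidal structure. *)
Record monfunctor (C D : moncat) := MonFunctor {
  mf_fun :> functor C D;
  mf_str : monoidal mf_fun
}.
Definition mfT (C D : moncat) (F : monfunctor C D) (X Y : C) :=
  mf_T (mf_str F) X Y.
Definition mfU (C D : moncat) (F : monfunctor C D) := mf_U (mf_str F).

Definition tensor_equivalence (C D : moncat) (F : functor C D) : Prop :=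
  is_equivalence F /\ inhabited (monoidal F).

Definition is_braided (C D : moncat) (c : braiding C) (d : braiding D)
    (F : monfunctor C D) : Prop :=
  forall X Y : C, fwd (mfT F Y X) ∘ fmap F (fwd (c X Y)) =
    fwd (d (F X) (F Y)) ∘ fwd (mfT F X Y).

Section IdMonoidal.
Variable C : moncat.
Definition monfunctor_id : monfunctor C C.
Proof.
apply: (@MonFunctor C C (functor_id C)).
apply: (@Monoidal C C (functor_id C) (fun X Y => iso_id (X ⊗ Y))
  (iso_id munit)) => /= *.
all: by rewrite ?tensm1 ?comp1m ?compm1 ?comp1m.
Defined.
End IdMonoidal.

Section CompMonoidal.
Variables (C D E : moncat) (G : monfunctor D E) (F : monfunctor C D).
Let GF := functor_comp G F.

Definition mcomp_T (X Y : C) : iso (GF (X ⊗ Y)) (GF X ⊗ GF Y) :=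
  iso_comp (mfT G (F X) (F Y)) (fmap_iso G (mfT F X Y)).
Definition mcomp_U : iso (GF munit) munit :=
  iso_comp (mfU G) (fmap_iso G (mfU F)).

Lemma mcomp_nat (X X' Y Y' : C) (f : hom X X') (g : hom Y Y') :
  fwd (mcomp_T X' Y') ∘ fmap GF (f ⊠ g) =
  (fmap GF f ⊠ fmap GF g) ∘ fwd (mcomp_T X Y).
Proof.
by rewrite /= -compA -fmapM mf_T_nat fmapM compA mf_T_nat compA.
Qed.

Lemma mcomp_assoc (X Y Z : C) :
  fwd (assoc (GF X) (GF Y) (GF Z)) ∘ (fwd (mcomp_T X Y) ⊠ idm (GF Z))
    ∘ fwd (mcomp_T (X ⊗ Y) Z) =
  (idm (GF X) ⊠ fwd (mcomp_T Y Z)) ∘ fwd (mcomp_T X (Y ⊗ Z))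
    ∘ fmap GF (fwd (assoc X Y Z)).
Proof.
rewrite /= tensM1 tens1M ?compA.
rewrite -[in LHS](fmap1 G).
have HT := mf_T_nat (mf_str G) (fwd (mfT F X Y)) (idm (F Z)).
have HT' := mf_T_nat (mf_str G) (idm (F X)) (fwd (mfT F Y Z)).
rewrite (pre2 (esym HT)) ?compA -/(mfT G _ _) fmap1 (mf_assoc (mf_str G)).
rewrite -!compA -!fmapM ?compA (mf_assoc (mf_str F)) ?compA.
rewrite !fmapM ?compA; congr (_ ∘ _ ∘ _).
by rewrite -!compA HT' fmap1.
Qed.

Lemma mcomp_lunit (X : C) :
  fwd (lunit (GF X)) ∘ (fwd mcomp_U ⊠ idm (GF X)) ∘ fwd (mcomp_T munit X) =
  fmap GF (fwd (lunit X)).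
Proof.
rewrite /= tensM1 ?compA.
have HT := mf_T_nat (mf_str G) (fwd (mfU F)) (idm (F X)).
rewrite fmap1 in HT; rewrite (pre2 (esym HT)) ?compA (mf_lunit (mf_str G)).
by rewrite -!fmapM (mf_lunit (mf_str F)).
Qed.

Lemma mcomp_runit (X : C) :
  fwd (runit (GF X)) ∘ (idm (GF X) ⊠ fwd mcomp_U) ∘ fwd (mcomp_T X munit) =
  fmap GF (fwd (runit X)).
Proof.
rewrite /= tens1M ?compA.
have HT := mf_T_nat (mf_str G) (idm (F X)) (fwd (mfU F)).
rewrite fmap1 in HT; rewrite (pre2 (esym HT)) ?compA (mf_runit (mf_str G)).
by rewrite -!fmapM (mf_runit (mf_str F)).
Qed.

Definition monfunctor_comp : monfunctor C E :=
  MonFunctor (Monoidal mcomp_nat mcomp_assoc mcomp_lunit mcomp_runit).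

End CompMonoidal.

Record monnatiso (C D : moncat) (F G : monfunctor C D) := MonNatIso {
  mn_iso :> natiso F G;
  mn_T : forall X Y : C, fwd (mfT G X Y) ∘ fwd (mn_iso (X ⊗ Y)) =
    (fwd (mn_iso X) ⊠ fwd (mn_iso Y)) ∘ fwd (mfT F X Y);
  mn_U : fwd (mfU G) ∘ fwd (mn_iso munit) = fwd (mfU F)
}.

Section Rigid.
Variable C : moncat.

(* [Y] is left dual to [X], equivalently [X] is right dual to [Y]. *)
Definition is_dual (Y X : C) : Prop :=
  exists (ev : hom (Y ⊗ X) munit) (coev : hom munit (X ⊗ Y)),
    fwd (runit X) ∘ (idm X ⊠ ev) ∘ fwd (assoc X Y X) ∘ (coev ⊠ idm X)
      ∘ bwd (lunit X) = idm X /\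
    fwd (lunit Y) ∘ (ev ⊠ idm Y) ∘ bwd (assoc Y X Y) ∘ (idm Y ⊠ coev)
      ∘ bwd (runit Y) = idm Y.

(* Monoidal functors preserve duals, so that rigidity of the categories
   imposes no further condition on tensor functors between them. *)
Definition rigid : Prop :=
  forall X : C, (exists Y, is_dual Y X) /\ (exists Y, is_dual X Y).

End Rigid.

Record algebra (C : moncat) := Algebra {
  al_ob :> C;
  al_mul : hom (al_ob ⊗ al_ob) al_ob;
  al_one : hom munit al_ob;
  al_assoc : al_mul ∘ (al_mul ⊠ idm al_ob) =
    al_mul ∘ (idm al_ob ⊠ al_mul) ∘ fwd (assoc al_ob al_ob al_ob);
  al_lunit : al_mul ∘ (al_one ⊠ idm al_ob) = fwd (lunit al_ob);
  al_runit : al_mul ∘ (idm al_ob ⊠ al_one) = fwd (runit al_ob)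
}.

Record module (C : moncat) (A : algebra C) := Module {
  mod_ob :> C;
  mod_act : hom (A ⊗ mod_ob) mod_ob;
  mod_assoc : mod_act ∘ (al_mul A ⊠ idm mod_ob) =
    mod_act ∘ (idm A ⊠ mod_act) ∘ fwd (assoc A A mod_ob);
  mod_lunit : mod_act ∘ (al_one A ⊠ idm mod_ob) = fwd (lunit mod_ob)
}.

Section Rep.
Variables (C : moncat) (A : algebra C).

Definition is_modhom (X Y : module A) (f : hom X Y) : bool :=
  f ∘ mod_act X == mod_act Y ∘ (idm A ⊠ f).

Record modhom (X Y : module A) := ModHom {
  modhom_val : hom X Y;
  modhom_valP : modhom_val \in @is_modhom X Y
}.

Section ModHomZmod.
Variables X Y : module A.
HB.instance Definition _ := [isSub of modhom X Y for @modhom_val X Y].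
HB.instance Definition _ := [Choice of modhom X Y by <:].
Lemma is_modhom_zmod : zmod_closed (@is_modhom X Y).
Proof.
split=> [|f g]; rewrite !unfold_in /is_modhom.
  by rewrite comp0m tensm0 compm0.
move=> /eqP Ef /eqP Eg; apply/eqP.
by rewrite compDl compNm tensmDr tensmN compDr compmN Ef Eg.
Qed.
HB.instance Definition _ :=
  GRing.isZmodClosed.Build (hom X Y) (@is_modhom X Y) is_modhom_zmod.
HB.instance Definition _ := [SubChoice_isSubZmodule of modhom X Y by <:].
End ModHomZmod.

Lemma modhomP (X Y : module A) (f : hom X Y) :
  f ∘ mod_act X = mod_act Y ∘ (idm A ⊠ f) -> f \in @is_modhom X Y.
Proof. by move=> E; apply/eqP. Qed.
Lemma modhomE (X Y : module A) (f : modhom X Y) :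
  modhom_val f ∘ mod_act X = mod_act Y ∘ (idm A ⊠ modhom_val f).
Proof. exact/eqP/(valP f). Qed.

Lemma modhom_id_subproof (X : module A) : idm (X : C) \in @is_modhom X X.
Proof. by apply: modhomP; rewrite tensm1 comp1m compm1. Qed.
Lemma modhom_comp_subproof (X Y Z : module A) (g : modhom Y Z)
  (f : modhom X Y) : modhom_val g ∘ modhom_val f \in @is_modhom X Z.
Proof.
by apply: modhomP; rewrite -compA modhomE compA modhomE tens1M compA.
Qed.

Definition Rep : preadditive.
Proof.
apply: (@Preadditive (module A) (fun X Y => modhom X Y)
  (fun X => ModHom (modhom_id_subproof X))
  (fun X Y Z g f => ModHom (modhom_comp_subproof g f))) => *;
apply: val_inj => /=.
- exact: compA.
- exact: comp1m.
- exact: compm1.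
- exact: compDl.
- exact: compDr.
Defined.

Definition rval (X Y : Rep) (f : hom X Y) : hom (mod_ob X) (mod_ob Y) :=
  modhom_val f.

Lemma rval_inj (X Y : Rep) (f g : hom X Y) : rval f = rval g -> f = g.
Proof. exact: val_inj. Qed.
Lemma rvalE (X Y : Rep) (f : hom X Y) :
  rval f ∘ mod_act X = mod_act Y ∘ (idm A ⊠ rval f).
Proof. exact: modhomE. Qed.

Definition rhom (X Y : Rep) (f : hom (mod_ob X) (mod_ob Y))
  (E : f ∘ mod_act X = mod_act Y ∘ (idm A ⊠ f)) : hom X Y :=
  ModHom (modhomP E).

Definition forget : functor Rep C :=
  @Functor Rep C (fun X => mod_ob X) (fun X Y f => rval f)
    (fun X => erefl) (fun X Y Z g f => erefl) (fun X Y f g => erefl).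

Lemma riso_subproof (X Y : Rep) (i : iso (mod_ob X) (mod_ob Y)) :
  fwd i ∘ mod_act X = mod_act Y ∘ (idm A ⊠ fwd i) ->
  bwd i ∘ mod_act Y = mod_act X ∘ (idm A ⊠ bwd i).
Proof.
move=> E; apply: (fwd_injr (i := tens_iso (iso_id (A : C)) i)) => /=.
by rewrite -!compA -E -tensmM fwdK comp1m tensm1 compm1 compA fwdK comp1m.
Qed.
Lemma risoK (X Y : Rep) (i : iso (mod_ob X) (mod_ob Y))
    (E : fwd i ∘ mod_act X = mod_act Y ∘ (idm A ⊠ fwd i)) :
  (rhom (riso_subproof E) : hom Y X) ∘ (rhom E : hom X Y) = idm X.
Proof. exact/rval_inj/(fwdK i). Qed.
Lemma risoK' (X Y : Rep) (i : iso (mod_ob X) (mod_ob Y))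
    (E : fwd i ∘ mod_act X = mod_act Y ∘ (idm A ⊠ fwd i)) :
  (rhom E : hom X Y) ∘ (rhom (riso_subproof E) : hom Y X) = idm Y.
Proof. exact/rval_inj/(bwdK i). Qed.
Definition riso (X Y : Rep) (i : iso (mod_ob X) (mod_ob Y))
    (E : fwd i ∘ mod_act X = mod_act Y ∘ (idm A ⊠ fwd i)) : iso X Y :=
  Iso (risoK E) (risoK' E).

End Rep.

Section RepAbelian.
Variables (C : tensorcat) (A : algebra C).
Notation RA := (Rep A).

Lemma kernel_mono (X Y K : C) (k : hom K X) (f : hom X Y) :
  is_kernel k f -> mono k.
Proof.
move=> [fk0 kU] W g h E.
have [|s [_ sU]] := kU W (k ∘ g); first by rewrite compA fk0 comp0m.
by rewrite -(sU g) // -(sU h).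
Qed.
Lemma cokernel_epi (X Y Q : C) (q : hom Y Q) (f : hom X Y) :
  is_cokernel q f -> epi q.
Proof.
move=> [qf0 qU] Z g h E.
have [|s [_ sU]] := qU Z (g ∘ q); first by rewrite -compA qf0 compm0.
by rewrite -(sU g) // -(sU h).
Qed.

(* Kernels and cokernels in [C] of module homomorphisms carry unique module
   structures, for which they are kernels and cokernels of modules. *)
Lemma rep_kernel_of (X Y Z : RA) (f : hom X Y) (k : hom Z X) :
  is_kernel (rval k) (rval f) -> is_kernel k f.
Proof.
move=> kf; have km := kernel_mono kf; case: kf => fk0 kU.
split=> [|W g fg0]; first exact: rval_inj.
have [|h [Eh hU]] := kU W (rval g); first exact: (congr1 (@rval _ _ _ _) fg0).
have hP : h ∘ mod_act W = mod_act Z ∘ (idm (A : C) ⊠ h).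
  have Ek := rvalE k.
  by apply: km; rewrite compA Eh rvalE -Eh tens1M [RHS]compA Ek compA.
exists (rhom hP : hom W Z); split; first exact: rval_inj.
by move=> h' Eh'; apply: rval_inj; apply: hU; rewrite -Eh'.
Qed.

Lemma rep_cokernel_of (X Y Z : RA) (f : hom X Y) (q : hom Y Z) :
  is_cokernel (rval q) (rval f) -> is_cokernel q f.
Proof.
move=> qf; have qe := cokernel_epi (tc_rexactl (A : C) qf).
case: qf => qf0 qU; split=> [|W g gf0]; first exact: rval_inj.
have [|h [Eh hU]] := qU W (rval g); first exact: (congr1 (@rval _ _ _ _) gf0).
have hP : h ∘ mod_act Z = mod_act W ∘ (idm (A : C) ⊠ h).
  apply: qe; rewrite -!compA -tens1M Eh -rvalE -rvalE compA Eh //.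
exists (rhom hP : hom Z W); split; first exact: rval_inj.
by move=> h' Eh'; apply: rval_inj; apply: hU; rewrite -Eh'.
Qed.

Lemma rep_kernel_lift (X Y : RA) (f : hom X Y) (K : C) (k : hom K (mod_ob X)) :
  is_kernel k (rval f) -> exists Z : RA, exists E : mod_ob Z = K,
    exists j : hom Z X, rval j = k ∘ (eq_rect _ (hom (mod_ob Z)) (idm _) K E).
Proof.
move=> kf; have km := kernel_mono kf; case: kf => fk0 kU.
have [|a [Ea _]] := kU _ (mod_act X ∘ (idm (A : C) ⊠ k)).
  by rewrite compA rvalE -compA -tens1M fk0 tensm0 compm0.
have aA : a ∘ (al_mul A ⊠ idm K) = a ∘ (idm (A : C) ⊠ a) ∘ fwd (assoc (A : C) A K).
  apply: km; rewrite !compA Ea -(compA (mod_act X)) -[idm _ ⊠ k ∘ _]tens_swap.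
  rewrite compA mod_assoc -!compA -tensm1 assoc_nat !compA; congr (_ ∘ _).
  by rewrite -!compA -!tens1M Ea.
have aU : a ∘ (al_one A ⊠ idm K) = fwd (lunit K).
  by apply: km; rewrite compA Ea -compA -tens_swap compA mod_lunit lunit_nat.
exists (Module aA aU), erefl.
have E : k ∘ mod_act (Module aA aU) = mod_act X ∘ (idm (A : C) ⊠ k) by [].
by exists (@rhom _ A (Module aA aU) X k E); rewrite /= compm1.
Qed.

Lemma rep_cokernel_lift (X Y : RA) (f : hom X Y) (Q : C)
    (q : hom (mod_ob Y) Q) :
  is_cokernel q (rval f) -> exists Z : RA, exists E : mod_ob Z = Q,
    exists j : hom Y Z, eq_rect _ (hom (mod_ob Y)) (rval j) Q E = q.
Proof.
move=> qf; have qA := tc_rexactl (A : C) qf; have qe := cokernel_epi qA.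
have qeA := cokernel_epi (tc_rexactl ((A : C) ⊗ A) qf).
have q1 := cokernel_epi (tc_rexactl munit qf).
case: qf => qf0 _; case: (qA) => _ qU.
have [|a [Ea _]] := qU _ (q ∘ mod_act Y).
  by rewrite -compA -rvalE compA qf0 comp0m.
have aA : a ∘ (al_mul A ⊠ idm Q) = a ∘ (idm (A : C) ⊠ a) ∘ fwd (assoc (A : C) A Q).
  apply: qeA; rewrite -compA tens_swap compA Ea -compA mod_assoc.
  rewrite -[RHS]compA -tensm1 assoc_nat !compA; congr (_ ∘ _).
  by rewrite -[RHS]compA -tens1M Ea tens1M compA Ea.
have aU : a ∘ (al_one A ⊠ idm Q) = fwd (lunit Q).
  by apply: q1; rewrite -compA tens_swap compA Ea -compA mod_lunit lunit_nat.
exists (Module aA aU), erefl.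
have E : q ∘ mod_act Y = mod_act (Module aA aU) ∘ (idm (A : C) ⊠ q) by [].
by exists (@rhom _ A Y (Module aA aU) q E).
Qed.

Lemma rep_has_kernel (X Y : RA) (f : hom X Y) :
  exists (K : RA) (k : hom K X), is_kernel (rval k) (rval f).
Proof.
have [K [k kf]] := ab_kernel (tc_ab C) (rval f).
have [Z [E [j Ej]]] := rep_kernel_lift kf.
by subst K; exists Z, j; rewrite Ej /= compm1.
Qed.
Lemma rep_has_cokernel (X Y : RA) (f : hom X Y) :
  exists (Q : RA) (q : hom Y Q), is_cokernel (rval q) (rval f).
Proof.
have [Q [q qf]] := ab_cokernel (tc_ab C) (rval f).
have [Z [E [j Ej]]] := rep_cokernel_lift qf.
by subst Q; exists Z, j; rewrite -Ej in qf.
Qed.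

Lemma rep_mono (X Y : RA) (f : hom X Y) : mono f -> mono (rval f).
Proof.
move=> fm W g h E; have [K [k kf]] := rep_has_kernel f.
have k0 : k = 0.
  apply: fm; apply: rval_inj; apply: (etrans (proj1 kf)).
  by exact/esym/compm0.
apply/eqP; rewrite -subr_eq0; apply/eqP.
have [|s [<- _]] := proj2 kf W (g - h).
  by rewrite compDr compmN E subrr.
by rewrite k0 comp0m.
Qed.
Lemma rep_epi (X Y : RA) (f : hom X Y) : epi f -> epi (rval f).
Proof.
move=> fe W g h E; have [Q [q qf]] := rep_has_cokernel f.
have q0 : q = 0.
  apply: fe; apply: rval_inj; apply: (etrans (proj1 qf)).
  by exact/esym/comp0m.
apply/eqP; rewrite -subr_eq0; apply/eqP.
have [|s [<- _]] := proj2 qf W (g - h).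
  by rewrite compDl compNm E subrr.
by rewrite q0 compm0.
Qed.

Lemma kernel_of_cokernel (X Y Q Z : C) (f : hom X Y) (g : hom Y Z)
  (q : hom Y Q) : is_kernel f g -> is_cokernel q f -> is_kernel f q.
Proof.
move=> fg [qf0 qU]; have [gf0 fU] := fg; split=> // W h qh0; apply: fU.
by have [s [<- _]] := qU _ g gf0; rewrite -compA qh0 compm0.
Qed.
Lemma cokernel_of_kernel (X Y K W : C) (f : hom X Y) (g : hom W X)
  (k : hom K X) : is_cokernel f g -> is_kernel k f -> is_cokernel f k.
Proof.
move=> fg [fk0 kU]; have [fg0 fU] := fg; split=> // Z h hk0; apply: fU.
by have [s [<- _]] := kU _ g fg0; rewrite compA hk0 comp0m.
Qed.

Lemma rep_zero : exists Z : RA, is_zero_object Z.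
Proof.
have [Z Z0] := ab_zero (tc_ab C); rewrite /is_zero_object in Z0.
have H (X : C) (f g : hom X Z) : f = g.
  by rewrite -(comp1m f) -(comp1m g) Z0 !comp0m.
exists (@Module _ A Z 0 (H _ _ _) (H _ _ _)).
exact/rval_inj/Z0.
Qed.

Lemma rep_biproduct (X Y : RA) : exists S (i1 : hom X S) (i2 : hom Y S)
  (p1 : hom S X) (p2 : hom S Y), is_biproduct i1 i2 p1 p2.
Proof.
have [S [i1 [i2 [p1 [p2 [p11 p22 p21 p12 p1D]]]]]] :=
  ab_biproduct (tc_ab C) (mod_ob X) (mod_ob Y).
pose a := i1 ∘ mod_act X ∘ (idm (A : C) ⊠ p1) + i2 ∘ mod_act Y ∘ (idm (A : C) ⊠ p2).
have jm W (f g : hom W S) : p1 ∘ f = p1 ∘ g -> p2 ∘ f = p2 ∘ g -> f = g.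
  move=> E1 E2; rewrite -(comp1m f) -(comp1m g) -p1D !compDl -!compA.
  by rewrite E1 E2.
have a1 : p1 ∘ a = mod_act X ∘ (idm (A : C) ⊠ p1).
  by rewrite /a compDr !compA p11 p12 !comp0m addr0 comp1m.
have a2 : p2 ∘ a = mod_act Y ∘ (idm (A : C) ⊠ p2).
  by rewrite /a compDr !compA p22 p21 !comp0m add0r comp1m.
have pA (P : RA) (p : hom S P) : p ∘ a = mod_act P ∘ (idm (A : C) ⊠ p) ->
    p ∘ (a ∘ (al_mul A ⊠ idm S)) =
    p ∘ (a ∘ (idm (A : C) ⊠ a) ∘ fwd (assoc (A : C) A S)).
  move=> E; rewrite !compA E -(compA (mod_act P)) -tens_swap compA mod_assoc.
  rewrite -!compA -tensm1 assoc_nat; congr (_ ∘ _).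
  by rewrite !compA -!tens1M E.
have aA : a ∘ (al_mul A ⊠ idm S) =
    a ∘ (idm (A : C) ⊠ a) ∘ fwd (assoc (A : C) A S).
  by apply: jm; exact: pA.
have aU : a ∘ (al_one A ⊠ idm S) = fwd (lunit S).
  by apply: jm; rewrite compA (a1, a2) -compA -tens_swap compA mod_lunit
    lunit_nat.
pose M : RA := Module aA aU.
have E1 : i1 ∘ mod_act X = mod_act M ∘ (idm (A : C) ⊠ i1).
  apply: jm; rewrite /= compA [RHS]compA (a1, a2) -[RHS]compA -tens1M.
    by rewrite p11 tensm1 comp1m compm1.
  by rewrite p21 comp0m tensm0 compm0.
have E2 : i2 ∘ mod_act Y = mod_act M ∘ (idm (A : C) ⊠ i2).
  apply: jm; rewrite /= compA [RHS]compA (a1, a2) -[RHS]compA -tens1M.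
    by rewrite p12 comp0m tensm0 compm0.
  by rewrite p22 tensm1 comp1m compm1.
exists M, (@rhom _ A X M i1 E1), (@rhom _ A Y M i2 E2),
  (@rhom _ A M X p1 a1), (@rhom _ A M Y p2 a2).
by split; apply: rval_inj.
Qed.

Lemma Rep_abelian : abelian RA.
Proof.
split.
- exact: rep_zero.
- exact: rep_biproduct.
- move=> X Y f; have [K [k kf]] := rep_has_kernel f.
  by exists K, k; exact: rep_kernel_of.
- move=> X Y f; have [Q [q qf]] := rep_has_cokernel f.
  by exists Q, q; exact: rep_cokernel_of.
- move=> X Y f /rep_mono fm; have [Z [g fg]] := ab_mono (tc_ab C) fm.
  have [Q [q qf]] := rep_has_cokernel f.
  by exists Q, q; apply: rep_kernel_of; apply: kernel_of_cokernel fg qf.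
- move=> X Y f /rep_epi fe; have [Z [g fg]] := ab_epi (tc_ab C) fe.
  have [K [k kf]] := rep_has_kernel f.
  by exists K, k; apply: rep_cokernel_of; apply: cokernel_of_kernel fg kf.
Qed.

(* A cokernel in the category of modules is one in [C]. *)
Lemma rep_cokernel_forget (X Y Z : RA) (f : hom X Y) (q : hom Y Z) :
  is_cokernel q f -> is_cokernel (rval q) (rval f).
Proof.
move=> [qf0 qU]; have [Q [p pf]] := rep_has_cokernel f.
have [p0 pU] := pf; have [|s [Es _]] := qU Q p; first exact: rval_inj.
have [_ {}pU'] := rep_cokernel_of pf.
have [|r [Er _]] := pU' Z q; first by [].
have rs : r ∘ s = idm Z.
  have [|z [_ zU]] := qU Z q; first by [].
  by rewrite -(zU (idm Z)) ?comp1m // -(zU (r ∘ s)) // -compA Es.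
split=> [|W g gf0]; first exact: (congr1 (@rval _ _ _ _) qf0).
have [h [Eh hU]] := pU W g gf0.
exists (h ∘ rval s); split.
  have Esq : rval s ∘ rval q = rval p by rewrite -Es.
  by rewrite -compA Esq.
move=> h' Eh'; rewrite (hU (h' ∘ rval r)).
  have Ers : rval r ∘ rval s = idm _ by exact: (congr1 (@rval _ _ _ _) rs).
  by rewrite -compA Ers compm1.
have Erp : rval r ∘ rval p = rval q by rewrite -Er.
by rewrite -compA Erp.
Qed.

End RepAbelian.

Record rmodcat (C : moncat) := RModCat {
  rm_cat :> preadditive;
  ract : rm_cat -> C -> rm_cat;
  ractm : forall (M M' : rm_cat) (V V' : C),
    hom M M' -> hom V V' -> hom (ract M V) (ract M' V');
  rassoc : forall M V W, iso (ract (ract M V) W) (ract M (V ⊗ W));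
  rone : forall M, iso (ract M munit) M;
  ractm1 : forall M V, ractm (idm M) (idm V) = idm (ract M V);
  ractmM : forall (M M' M'' : rm_cat) (V V' V'' : C) (f' : hom M' M'')
      (f : hom M M') (g' : hom V' V'') (g : hom V V'),
    ractm (f' ∘ f) (g' ∘ g) = ractm f' g' ∘ ractm f g;
  ractmDl : forall (M M' : rm_cat) (V V' : C) (f f' : hom M M') (g : hom V V'),
    ractm (f + f') g = ractm f g + ractm f' g;
  ractmDr : forall (M M' : rm_cat) (V V' : C) (f : hom M M') (g g' : hom V V'),
    ractm f (g + g') = ractm f g + ractm f g';
  rassoc_nat : forall (M M' : rm_cat) (V V' W W' : C) (f : hom M M')
      (g : hom V V') (h : hom W W'),
    fwd (rassoc M' V' W') ∘ ractm (ractm f g) h =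
    ractm f (g ⊠ h) ∘ fwd (rassoc M V W);
  rone_nat : forall (M M' : rm_cat) (f : hom M M'),
    fwd (rone M') ∘ ractm f (idm munit) = f ∘ fwd (rone M);
  rpentagon : forall M V W U,
    fwd (rassoc M V (W ⊗ U)) ∘ fwd (rassoc (ract M V) W U) =
    ractm (idm M) (fwd (assoc V W U)) ∘ fwd (rassoc M (V ⊗ W) U)
      ∘ ractm (fwd (rassoc M V W)) (idm U);
  rtriangle : forall M V,
    ractm (idm M) (fwd (lunit V)) ∘ fwd (rassoc M munit V) =
    ractm (fwd (rone M)) (idm V)
}.

Record module_functor (C : moncat) (M N : rmodcat C) (F : functor M N) :=
  ModuleFunctor {
  mo_T : forall (X : M) (V : C), iso (F (ract X V)) (ract (F X) V);
  mo_nat : forall (X X' : M) (V V' : C) (f : hom X X') (g : hom V V'),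
    fwd (mo_T X' V') ∘ fmap F (ractm f g) =
    ractm (fmap F f) g ∘ fwd (mo_T X V);
  mo_assoc : forall (X : M) (V W : C),
    fwd (rassoc (F X) V W) ∘ ractm (fwd (mo_T X V)) (idm W)
      ∘ fwd (mo_T (ract X V) W) =
    fwd (mo_T X (V ⊗ W)) ∘ fmap F (fwd (rassoc X V W));
  mo_unit : forall X : M,
    fwd (rone (F X)) ∘ fwd (mo_T X munit) = fmap F (fwd (rone X))
}.

(* [M.V] is [M ⊗ V] with [A] acting on the first factor. *)
Section RepRMod.
Variables (C : moncat) (A : algebra C).

Definition dot_act (M : module A) (V : C) :
    hom (A ⊗ (mod_ob M ⊗ V)) (mod_ob M ⊗ V) :=
  (mod_act M ⊠ idm V) ∘ bwd (assoc (A : C) M V).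

Lemma dot_assoc (M : module A) (V : C) :
  dot_act M V ∘ (al_mul A ⊠ idm (mod_ob M ⊗ V)) =
  dot_act M V ∘ (idm (A : C) ⊠ dot_act M V) ∘ fwd (assoc (A : C) A (M ⊗ V)).
Proof.
rewrite /dot_act; flatten C.
by flatten_in C (mod_assoc M) (V ⊗ t).
Qed.

Lemma dot_lunit (M : module A) (V : C) :
  dot_act M V ∘ (al_one A ⊠ idm (mod_ob M ⊗ V)) = fwd (lunit (mod_ob M ⊗ V)).
Proof.
rewrite /dot_act; flatten C.
by flatten_in C (mod_lunit M) (V ⊗ t).
Qed.

Definition dot (M : Rep A) (V : C) : Rep A :=
  Module (dot_assoc M V) (dot_lunit M V).

Lemma dotm_subproof (M M' : Rep A) (V V' : C) (f : hom M M') (g : hom V V') :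
  (rval f ⊠ g) ∘ dot_act M V = dot_act M' V' ∘ (idm (A : C) ⊠ (rval f ⊠ g)).
Proof.
apply: (fwd_injr (i := assoc (A : C) (mod_ob M) V)).
rewrite /dot_act -!compA fwdK compm1 -assoc_nat (compA (bwd _)) fwdK comp1m.
by rewrite -!tensmM rvalE comp1m compm1.
Qed.
Definition dotm (M M' : Rep A) (V V' : C) (f : hom M M') (g : hom V V') :
    hom (dot M V) (dot M' V') :=
  @rhom _ _ (dot M V) (dot M' V') _ (dotm_subproof f g).

Lemma dot_rassoc_subproof (M : Rep A) (V W : C) :
  fwd (assoc (mod_ob M) V W) ∘ mod_act (dot (dot M V) W) =
  mod_act (dot M (V ⊗ W)) ∘ (idm (A : C) ⊠ fwd (assoc (mod_ob M) V W)).
Proof. by rewrite /= /dot_act /= /dot_act; flatten C. Qed.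
Definition dot_rassoc (M : Rep A) (V W : C) :
    iso (dot (dot M V) W) (dot M (V ⊗ W)) :=
  @riso _ _ (dot (dot M V) W) (dot M (V ⊗ W)) _ (dot_rassoc_subproof M V W).

Lemma dot_rone_subproof (M : Rep A) :
  fwd (runit (mod_ob M)) ∘ mod_act (dot M munit) =
  mod_act M ∘ (idm (A : C) ⊠ fwd (runit (mod_ob M))).
Proof. by rewrite /= /dot_act; flatten C. Qed.
Definition dot_rone (M : Rep A) : iso (dot M munit) M :=
  @riso _ _ (dot M munit) M _ (dot_rone_subproof M).

Definition Rep_rmod : rmodcat C.
Proof.
apply: (@RModCat C (Rep A) dot dotm dot_rassoc dot_rone) => *;
apply: rval_inj.
- exact: tensm1.
- exact: tensmM.
- exact: tensmDl.
- exact: tensmDr.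
- exact: assoc_nat.
- exact: runit_nat.
- exact: pentagon.
- exact: triangle.
Defined.

End RepRMod.

(* A monoidal functor [i : C -> B] turns [B] into a right [C]-module category
   by [N.V = N ⊗ i V]. *)
Section RestrictRMod.
Variables (C B : moncat) (i : monfunctor C B).

Lemma iso_square (D : preadditive) (X X' Y Y' : D) (j : iso X X')
    (k : iso Y Y') (f : hom Y X) (g : hom Y' X') :
  g ∘ fwd k = fwd j ∘ f -> bwd j ∘ g = f ∘ bwd k.
Proof.
move=> E; apply: (fwd_inj (i := j)); apply: (fwd_injr (i := k)).
by rewrite compA bwdK comp1m E -!compA fwdK compm1.
Qed.

Definition res_rassoc (N : B) (V W : C) :
    iso ((N ⊗ i V) ⊗ i W) (N ⊗ i (V ⊗ W)) :=
  iso_comp (tens_iso (iso_id N) (iso_inv (mfT i V W))) (assoc N (i V) (i W)).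
Definition res_rone (N : B) : iso (N ⊗ i munit) N :=
  iso_comp (runit N) (tens_iso (iso_id N) (mfU i)).

Lemma res_T_nat (V V' W W' : C) (g : hom V V') (h : hom W W') :
  bwd (mfT i V' W') ∘ (fmap i g ⊠ fmap i h) =
  fmap i (g ⊠ h) ∘ bwd (mfT i V W).
Proof.
by apply: iso_square; rewrite (mf_T_nat (mf_str i)).
Qed.

Lemma res_assoc_nat (N N' : B) (V V' W W' : C) (f : hom N N')
    (g : hom V V') (h : hom W W') :
  fwd (res_rassoc N' V' W') ∘ ((f ⊠ fmap i g) ⊠ fmap i h) =
  (f ⊠ fmap i (g ⊠ h)) ∘ fwd (res_rassoc N V W).
Proof.
rewrite /= -compA assoc_nat !compA; congr (_ ∘ _).
by rewrite -!tensmM comp1m compm1 res_T_nat.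
Qed.

Lemma res_one_nat (N N' : B) (f : hom N N') :
  fwd (res_rone N') ∘ (f ⊠ fmap i (idm munit)) = f ∘ fwd (res_rone N).
Proof. by rewrite /= fmap1 -compA -tens_swap compA runit_nat compA. Qed.

Lemma res_pentagon (N : B) (V W U : C) :
  fwd (res_rassoc N V (W ⊗ U)) ∘ fwd (res_rassoc (N ⊗ i V) W U) =
  (idm N ⊠ fmap i (fwd (assoc V W U))) ∘ fwd (res_rassoc N (V ⊗ W) U)
    ∘ (fwd (res_rassoc N V W) ⊠ fmap i (idm U)).
Proof.
have E : bwd (mfT i V (W ⊗ U)) ∘ (idm (i V) ⊠ bwd (mfT i W U))
   ∘ fwd (assoc (i V) (i W) (i U)) =
  fmap i (fwd (assoc V W U)) ∘ bwd (mfT i (V ⊗ W) U)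
   ∘ (bwd (mfT i V W) ⊠ idm (i U)).
  rewrite -[RHS]compA; apply: (@iso_square _ _ _ _ _
    (iso_comp (tens_iso (iso_id (i V)) (mfT i W U)) (mfT i V (W ⊗ U)))
    (iso_comp (tens_iso (mfT i V W) (iso_id (i U))) (mfT i (V ⊗ W) U))).
  by rewrite /= compA; exact: (mf_assoc (mf_str i)).
rewrite /= fmap1 tensM1 ?compA -(tensm1 N (i V)) (pre2 (assoc_nat _ _ _)).
rewrite ?compA (pre2 (pentagon _ _ _ _)) ?compA -!tens1M ?compA E.
rewrite (pre2 (assoc_nat _ _ _)) ?compA -!tens1M ?compA //.
Qed.

Lemma res_triangle (N : B) (V : C) :
  (idm N ⊠ fmap i (fwd (lunit V))) ∘ fwd (res_rassoc N munit V) =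
  fwd (res_rone N) ⊠ fmap i (idm V).
Proof.
have E : fmap i (fwd (lunit V)) ∘ bwd (mfT i munit V) =
   fwd (lunit (i V)) ∘ (fwd (mfU i) ⊠ idm (i V)).
  by rewrite -(mf_lunit (mf_str i)) -compA bwdK compm1.
rewrite /= fmap1 tensM1 compA -tens1M E tens1M -compA -assoc_nat compA.
by rewrite triangle.
Qed.

Definition res_rmod : rmodcat C.
Proof.
apply: (@RModCat C B (fun N V => N ⊗ i V) (fun M M' V V' f g => f ⊠ fmap i g)
  res_rassoc res_rone).
- by move=> *; rewrite fmap1 tensm1.
- by move=> *; rewrite fmapM tensmM.
- by move=> *; exact: tensmDl.
- by move=> *; rewrite fmapD tensmDr.
- exact: res_assoc_nat.
- exact: res_one_nat.
- exact: res_pentagon.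
- exact: res_triangle.
Defined.

End RestrictRMod.

(* [(A ⊗ B) ⊗ (X ⊗ Y) -> (A ⊗ X) ⊗ (B ⊗ Y)], the morphism
   [id ⊗ c_{B,X} ⊗ id] with its associators. *)
Definition mid4 (C : moncat) (c : braiding C) (A B X Y : C) :
    hom ((A ⊗ B) ⊗ (X ⊗ Y)) ((A ⊗ X) ⊗ (B ⊗ Y)) :=
  bwd (assoc A X (B ⊗ Y)) ∘
  (idm A ⊠ (fwd (assoc X B Y) ∘ (fwd (c B X) ⊠ idm Y) ∘ bwd (assoc B X Y))) ∘
  fwd (assoc A B (X ⊗ Y)).

Record bialgebra (C : moncat) (c : braiding C) (A : algebra C) := Bialgebra {
  bi_comul : hom A (A ⊗ A);
  bi_counit : hom A munit;
  bi_coassoc : fwd (assoc (A : C) A A) ∘ (bi_comul ⊠ idm (A : C)) ∘ bi_comul =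
    (idm (A : C) ⊠ bi_comul) ∘ bi_comul;
  bi_counitl : fwd (lunit (A : C)) ∘ (bi_counit ⊠ idm (A : C)) ∘ bi_comul =
    idm (A : C);
  bi_counitr : fwd (runit (A : C)) ∘ (idm (A : C) ⊠ bi_counit) ∘ bi_comul =
    idm (A : C);
  bi_comul_mul : bi_comul ∘ al_mul A =
    (al_mul A ⊠ al_mul A) ∘ mid4 c A A A A ∘ (bi_comul ⊠ bi_comul);
  bi_comul_one : bi_comul ∘ al_one A =
    (al_one A ⊠ al_one A) ∘ bwd (lunit munit);
  bi_counit_mul : bi_counit ∘ al_mul A =
    fwd (lunit munit) ∘ (bi_counit ⊠ bi_counit);
  bi_counit_one : bi_counit ∘ al_one A = idm munit
}.

Record hopf_algebra (C : moncat) (c : braiding C) (A : algebra C) := HopfAlgebra {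
  ha_bi :> bialgebra c A;
  ha_antipode : iso (A : C) A;
  ha_antipodel : al_mul A ∘ (fwd ha_antipode ⊠ idm (A : C)) ∘ bi_comul ha_bi =
    al_one A ∘ bi_counit ha_bi;
  ha_antipoder : al_mul A ∘ (idm (A : C) ⊠ fwd ha_antipode) ∘ bi_comul ha_bi =
    al_one A ∘ bi_counit ha_bi
}.

Section BraidingUnit.
Variables (C : moncat) (c : braiding C).

Local Notation O := (@WO C).
Definition gbr (X Y t : C) : hom (X ⊗ (Y ⊗ t)) (Y ⊗ (X ⊗ t)) :=
  gen (a := WT (O X) (O Y)) (b := WT (O Y) (O X)) (fwd (c X Y)) t.

Lemma gbr_nat (X Y t t' : C) (g : hom t t') :
  gbr X Y t' ∘ (idm X ⊠ (idm Y ⊠ g)) = (idm Y ⊠ (idm X ⊠ g)) ∘ gbr X Y t.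
Proof. exact: (gen_nat (a := WT (O X) (O Y)) (b := WT (O Y) (O X))). Qed.

Lemma gen_br1 (X Y Z t : C) :
  gen (a := WT (O X) (WT (O Y) (O Z))) (b := WT (WT (O Y) (O Z)) (O X))
    (fwd (c X (Y ⊗ Z))) t =
  (idm Y ⊠ gbr X Z t) ∘ gbr X Y (Z ⊗ t).
Proof. by flatten_in C (br_hex1 c X Y Z) t. Qed.

Lemma gen_br2 (X Y Z t : C) :
  gen (a := WT (WT (O X) (O Y)) (O Z)) (b := WT (O Z) (WT (O X) (O Y)))
    (fwd (c (X ⊗ Y) Z)) t =
  gbr X Z (Y ⊗ t) ∘ (idm X ⊠ gbr Y Z t).
Proof. by flatten_in C (br_hex2 c X Y Z) t. Qed.

Lemma gen_iso_inj (a b : word C) (i : iso (wden a) (wden b)) (t : C)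
    (Z : C) (f g : hom (flat b t) Z) :
  f ∘ gen (fwd i) t = g ∘ gen (fwd i) t -> f = g.
Proof.
move=> /(congr1 (fun h => h ∘ gen (bwd i) t)).
have E : gen (fwd i) t ∘ gen (bwd i) t = idm _.
  rewrite !genE -!compA (compA (bwd (flati a t))) fwdK comp1m.
  by rewrite (compA (fwd i ⊠ _)) -tensM1 bwdK tensm1 comp1m bwdK.
by rewrite -!compA E !compm1.
Qed.

Lemma gen_brI (X t : C) :
  gen (a := WT (O X) (@WI C)) (b := WT (@WI C) (O X)) (fwd (c X munit)) t =
  idm (X ⊗ t).
Proof.
have H := br_nat c (idm X) (fwd (lunit munit)).
have H1 := br_hex1 c X munit munit.
apply: (@gen_iso_inj (WT (O X) (@WI C)) (WT (@WI C) (O X)) (c X munit) t).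
rewrite comp1m; flatten_in C H1 t => <-.
by flatten_in C H t.
Qed.

Lemma gen_Ibr (X t : C) :
  gen (a := WT (@WI C) (O X)) (b := WT (O X) (@WI C)) (fwd (c munit X)) t =
  idm (X ⊗ t).
Proof.
have H := br_nat c (fwd (lunit munit)) (idm X).
have H2 := br_hex2 c munit munit X.
apply: (@gen_iso_inj (WT (@WI C) (O X)) (WT (O X) (@WI C)) (c munit X) t).
rewrite comp1m; flatten_in C H2 t => <-.
by flatten_in C H t.
Qed.

End BraidingUnit.

Section RepTensor.
Variables (C : moncat) (c : braiding C) (A : algebra C) (b : bialgebra c A).
Local Notation n := (al_ob A).
Local Notation O := (@WO C).
Local Notation c_ := (gbr c).
Local Notation D := (bi_comul b).
Local Notation e := (bi_counit b).

Definition tens_act (X Y : module A) : hom (n ⊗ (mod_ob X ⊗ mod_ob Y)) (X ⊗ Y) :=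
  (mod_act X ⊠ mod_act Y) ∘ mid4 c n n X Y ∘ (D ⊠ idm (mod_ob X ⊗ mod_ob Y)).

Let gm t : hom (n ⊗ (n ⊗ t)) (n ⊗ t) :=
  gen (a := WT (O n) (O n)) (b := O n) (al_mul A) t.
Let gu t : hom t (n ⊗ t) := gen (a := @WI C) (b := O n) (al_one A) t.
Let gD t : hom (n ⊗ t) (n ⊗ (n ⊗ t)) :=
  gen (a := O n) (b := WT (O n) (O n)) D t.
Let ge t : hom (n ⊗ t) t := gen (a := O n) (b := @WI C) e t.
Let ga (X : module A) t : hom (n ⊗ (mod_ob X ⊗ t)) (mod_ob X ⊗ t) :=
  gen (a := WT (O n) (O (mod_ob X))) (b := O (mod_ob X)) (mod_act X) t.

Let gmN t t' (g : hom t t') : gm t' ∘ (idm n ⊠ (idm n ⊠ g)) = (idm n ⊠ g) ∘ gm t.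
Proof. exact: (gen_nat (a := WT (O n) (O n)) (b := O n)). Qed.
Let guN t t' (g : hom t t') : gu t' ∘ g = (idm n ⊠ g) ∘ gu t.
Proof. exact: (gen_nat (a := @WI C) (b := O n)). Qed.
Let gDN t t' (g : hom t t') : gD t' ∘ (idm n ⊠ g) = (idm n ⊠ (idm n ⊠ g)) ∘ gD t.
Proof. exact: (gen_nat (a := O n) (b := WT (O n) (O n))). Qed.
Let geN t t' (g : hom t t') : ge t' ∘ (idm n ⊠ g) = g ∘ ge t.
Proof. exact: (gen_nat (a := O n) (b := @WI C)). Qed.
Let gaN X t t' (g : hom t t') :
  ga X t' ∘ (idm n ⊠ (idm (mod_ob X) ⊠ g)) = (idm (mod_ob X) ⊠ g) ∘ ga X t.
Proof. exact: (gen_nat (a := WT (O n) (O (mod_ob X))) (b := O (mod_ob X))). Qed.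

Let gaA X t : ga X t ∘ gm (mod_ob X ⊗ t) = ga X t ∘ (idm n ⊠ ga X t).
Proof. by flatten_in C (mod_assoc X) t. Qed.
Let gau X t : ga X t ∘ gu (mod_ob X ⊗ t) = idm _.
Proof. by flatten_in C (mod_lunit X) t. Qed.
Let gDA t : gD (n ⊗ t) ∘ gD t = (idm n ⊠ gD t) ∘ gD t.
Proof. by flatten_in C (bi_coassoc b) t. Qed.
Let geDl t : ge (n ⊗ t) ∘ gD t = idm _.
Proof. by flatten_in C (bi_counitl b) t. Qed.
Let geDr t : (idm n ⊠ ge t) ∘ gD t = idm _.
Proof. by flatten_in C (bi_counitr b) t. Qed.
Let gem t : ge t ∘ gm t = ge t ∘ (ge (n ⊗ t)).
Proof. by flatten_in C (bi_counit_mul b) t => ->; rewrite geN. Qed.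
Let geu t : ge t ∘ gu t = idm _.
Proof. by flatten_in C (bi_counit_one b) t. Qed.
Let gDu t : gD t ∘ gu t = gu (n ⊗ t) ∘ gu t.
Proof. by flatten_in C (bi_comul_one b) t. Qed.
Let gDm t : gD t ∘ gm t = gm (n ⊗ t) ∘ (idm n ⊠ (idm n ⊠ gm t)) ∘
  (idm n ⊠ c_ n n (n ⊗ t)) ∘ gD (n ⊗ (n ⊗ t)) ∘ (idm n ⊠ gD t).
Proof.
have H := bi_comul_mul b; rewrite /mid4 in H.
by flatten_in C H t; rewrite ?tens1M ?tensm1 ?comp1m ?compm1 ?compA.
Qed.

Let cNm (X : C) t : c_ n X t ∘ gm (X ⊗ t) =
  (idm X ⊠ gm t) ∘ c_ n X (n ⊗ t) ∘ (idm n ⊠ c_ n X t).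
Proof.
have H := br_nat c (al_mul A) (idm X).
by flatten_in C H t; rewrite gen_br2 ?compA.
Qed.
Let cNu (X : C) t : c_ n X t ∘ gu (X ⊗ t) = idm X ⊠ gu t.
Proof.
have H := br_nat c (al_one A) (idm X).
by flatten_in C H t; rewrite gen_Ibr compm1.
Qed.
Let cNa (X : C) (M : module A) t : c_ X M t ∘ (idm X ⊠ ga M t) =
  ga M (X ⊗ t) ∘ (idm n ⊠ c_ X M t) ∘ c_ X n (M ⊗ t).
Proof.
have H := br_nat c (idm X) (mod_act M).
by flatten_in C H t; rewrite gen_br1 ?compA.
Qed.
Let cND (X : C) t : (idm X ⊠ gD t) ∘ c_ n X t =
  c_ n X (n ⊗ t) ∘ (idm n ⊠ c_ n X t) ∘ gD (X ⊗ t).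
Proof.
have H := br_nat c D (idm X).
by flatten_in C H t => <-; rewrite gen_br2 ?compA.
Qed.
Let cNe (X : C) t : (idm X ⊠ ge t) ∘ c_ n X t = ge (X ⊗ t).
Proof.
have H := br_nat c e (idm X).
by flatten_in C H t => <-; rewrite gen_Ibr comp1m.
Qed.

Let w2 (X Y Z T : C) (f : hom Z T) (g : hom Y Z) (r : hom Y T) :
  f ∘ g = r -> (idm X ⊠ f) ∘ (idm X ⊠ g) = idm X ⊠ r.
Proof. by move=> <-; rewrite tens1M. Qed.

Lemma tens_act_assoc (X Y : module A) :
  tens_act X Y ∘ (al_mul A ⊠ idm (mod_ob X ⊗ Y)) =
  tens_act X Y ∘ (idm n ⊠ tens_act X Y) ∘ fwd (assoc n n (X ⊗ Y)).
Proof.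
rewrite /tens_act /mid4; flatten C.
rewrite !tens1M ?compA (pre2 (gDm _)) ?compA.
rewrite (pre2 (esym (gmN (c_ n X _)))) ?compA.
rewrite (pre2 (esym (gmN (idm (mod_ob X) ⊠ ga Y t)))) ?compA gaA.
rewrite (pre2 (w2 n (w2 n (cNm X _)))) !tens1M ?compA.
rewrite (pre2 (w2 n (w2 n (w2 X (gaA Y t))))) !tens1M ?compA.
rewrite [in RHS](pre2 (gDN _)) ?compA.
rewrite [in RHS](pre2 (w2 n (cNa n X _))) ?tens1M ?compA.
rewrite [in RHS](pre2 (w2 n (esym (gaN X (ga Y t))))) ?tens1M ?compA.
rewrite [in RHS](pre2 (gDN _)) ?compA.
rewrite [in RHS](pre2 (gDN _)) ?compA.
rewrite [in RHS](pre2 (w2 n (gbr_nat c n n (idm (mod_ob X) ⊠ ga Y t))))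
  ?tens1M ?compA.
rewrite [in RHS](pre2 (w2 n (w2 n (gbr_nat c n X (ga Y t))))) ?tens1M ?compA.
by rewrite [in RHS](pre2 (w2 n (gbr_nat c n n (c_ n X _)))) ?tens1M ?compA.
Qed.

Lemma tens_act_lunit (X Y : module A) :
  tens_act X Y ∘ (al_one A ⊠ idm (mod_ob X ⊗ Y)) = fwd (lunit (mod_ob X ⊗ Y)).
Proof.
rewrite /tens_act /mid4; flatten C.
rewrite ?tens1M ?compA (pre2 (gDu _)) ?compA.
rewrite (pre2 (esym (guN (c_ n X _)))) ?compA (pre2 (cNu _ _)).
rewrite (pre2 (esym (guN (idm (mod_ob X) ⊠ ga Y t)))) ?compA gau comp1m.
by rewrite -tens1M gau tensm1.
Qed.

Definition tens_mod (X Y : Rep A) : Rep A :=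
  Module (tens_act_assoc X Y) (tens_act_lunit X Y).

Lemma unit_act_assoc :
  (fwd (runit munit) ∘ (e ⊠ idm munit)) ∘ (al_mul A ⊠ idm munit) =
  (fwd (runit munit) ∘ (e ⊠ idm munit)) ∘
    (idm n ⊠ (fwd (runit munit) ∘ (e ⊠ idm munit))) ∘ fwd (assoc n n munit).
Proof. by flatten C; rewrite gem geN. Qed.
Lemma unit_act_lunit :
  (fwd (runit munit) ∘ (e ⊠ idm munit)) ∘ (al_one A ⊠ idm munit) =
  fwd (lunit munit).
Proof. by flatten C; rewrite geu. Qed.

Definition unit_mod : Rep A := Module unit_act_assoc unit_act_lunit.

Lemma mid4_nat (X X' Y Y' : C) (f : hom X X') (g : hom Y Y') :
  mid4 c n n X' Y' ∘ (idm (n ⊗ n) ⊠ (f ⊠ g)) =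
  ((idm n ⊠ f) ⊠ (idm n ⊠ g)) ∘ mid4 c n n X Y.
Proof.
have H := br_nat c (idm n) f.
rewrite /mid4; flatten C; rewrite ?tens1M ?compA.
flatten_in C H (Y' ⊗ t); rewrite -/(c_ n X _) -/(c_ n X' _) => Hc.

rewrite ?(pre2 (w2 n Hc)) ?(w2 n Hc) ?tens1M ?compA.
by rewrite -?compA -!tens1M gbr_nat.
Qed.

Lemma tens_modm_subproof (X X' Y Y' : Rep A) (f : hom X X') (g : hom Y Y') :
  (rval f ⊠ rval g) ∘ mod_act (tens_mod X Y) =
  mod_act (tens_mod X' Y') ∘ (idm n ⊠ (rval f ⊠ rval g)).
Proof.
rewrite /= /tens_act; have := mid4_nat (rval f) (rval g).
move: (mid4 c n n (mod_ob X) Y) (mid4 c n n (mod_ob X') Y') => m1 m2 E.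
rewrite ?compA -[in LHS]tensmM (rvalE f) (rvalE g) tensmM.
by rewrite (pre2 (esym E)) ?compA -!compA -tens_swap.
Qed.

Definition tens_modm (X X' Y Y' : Rep A) (f : hom X X') (g : hom Y Y') :
    hom (tens_mod X Y) (tens_mod X' Y') :=
  @rhom _ _ (tens_mod X Y) (tens_mod X' Y') _ (tens_modm_subproof f g).

Lemma tens_assoc_subproof (X Y Z : Rep A) :
  fwd (assoc (mod_ob X) (mod_ob Y) (mod_ob Z)) ∘
    mod_act (tens_mod (tens_mod X Y) Z) =
  mod_act (tens_mod X (tens_mod Y Z)) ∘
    (idm n ⊠ fwd (assoc (mod_ob X) (mod_ob Y) (mod_ob Z))).
Proof.
rewrite /= /tens_act /= /tens_act /mid4; flatten C; rewrite ?tens1M ?compA.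
rewrite gen_br1 ?tens1M ?compA.
do !rewrite [in LHS](pre2 (gDN _)) ?compA.
rewrite [in LHS](pre2 (gDA _)) ?compA.
rewrite [in RHS](pre2 (w2 n (cND (mod_ob X) _))) ?tens1M ?compA.
rewrite [in RHS](pre2 (w2 n (esym (gbr_nat c n X _)))) ?tens1M ?compA.
by rewrite [in RHS](pre2 (w2 n (esym (gbr_nat c n X _)))) ?tens1M ?compA.
Qed.

Lemma tens_lunit_subproof (X : Rep A) :
  fwd (lunit (mod_ob X)) ∘ mod_act (tens_mod unit_mod X) =
  mod_act X ∘ (idm n ⊠ fwd (lunit (mod_ob X))).
Proof.
rewrite /= /tens_act /= /mid4; flatten C; rewrite ?tens1M ?compA.
rewrite gen_brI tensm1 compm1 geN.
by rewrite -compA geDl compm1.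
Qed.
Lemma tens_runit_subproof (X : Rep A) :
  fwd (runit (mod_ob X)) ∘ mod_act (tens_mod X unit_mod) =
  mod_act X ∘ (idm n ⊠ fwd (runit (mod_ob X))).
Proof.
rewrite /= /tens_act /= /mid4; flatten C; rewrite ?tens1M ?compA.
by rewrite (pre2 (w2 n (cNe (mod_ob X) t))) -compA geDr compm1.
Qed.

Definition Rep_moncat : moncat.
Proof.
apply: (@Moncat (Rep A) tens_mod tens_modm unit_mod
  (fun X Y Z => @riso _ _ (tens_mod (tens_mod X Y) Z)
     (tens_mod X (tens_mod Y Z)) _ (tens_assoc_subproof X Y Z))
  (fun X => @riso _ _ (tens_mod unit_mod X) X _ (tens_lunit_subproof X))
  (fun X => @riso _ _ (tens_mod X unit_mod) X _ (tens_runit_subproof X))) => *;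
apply: rval_inj.
- exact: tensm1.
- exact: tensmM.
- exact: tensmDl.
- exact: tensmDr.
- exact: assoc_nat.
- exact: lunit_nat.
- exact: runit_nat.
- exact: pentagon.
- exact: triangle.
Defined.

End RepTensor.

Definition Rep_tensorcat (C : tensorcat) (c : braiding C) (A : algebra C)
  (b : bialgebra c A) : tensorcat.
Proof.
apply: (@TensorCat (Rep_moncat b)).
- exact: Rep_abelian.
- move=> W X Y Q q f /rep_cokernel_forget qf; apply: rep_cokernel_of.
  exact: (tc_rexactl (mod_ob W) qf).
- move=> W X Y Q q f /rep_cokernel_forget qf; apply: rep_cokernel_of.
  exact: (tc_rexactr (mod_ob W) qf).
Defined.

(* Half-braidings are written in the direction [Z ⊗ N -> N ⊗ Z]; with this
   direction the braiding of the center is [c_{(Z,γ),(W,δ)} = γ_W].  For a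
   Hopf algebra [H] in [C] whose modules are tensored by means of [c_{H,X}],
   the trivial module on [V] commutes with an [H]-module [X] by the
   [H]-linear map [c_{X,V}^-1 : V ⊗ X -> X ⊗ V], so it is in this direction
   that the reversed category of [C] maps to the center by [c^-1]. *)
Record half_braiding (B : moncat) (Z : B) := HalfBraiding {
  hb :> forall N : B, iso (Z ⊗ N) (N ⊗ Z);
  hb_nat : forall (N N' : B) (f : hom N N'),
    fwd (hb N') ∘ (idm Z ⊠ f) = (f ⊠ idm Z) ∘ fwd (hb N);
  hb_hex : forall N M : B,
    fwd (assoc N M Z) ∘ fwd (hb (N ⊗ M)) ∘ fwd (assoc Z N M) =
    (idm N ⊠ fwd (hb M)) ∘ fwd (assoc N Z M) ∘ (fwd (hb N) ⊠ idm M)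
}.

Record center_ob (B : moncat) := CenterOb {
  ce_ob :> B;
  ce_hb : half_braiding ce_ob
}.

Section Center.
Variable B : moncat.
Local Notation O := (@WO B).

Definition is_center_hom (Z W : center_ob B) (f : hom Z W) : bool :=
  `[< forall N : B, (idm N ⊠ f) ∘ fwd (ce_hb Z N) =
                    fwd (ce_hb W N) ∘ (f ⊠ idm N) >].

Record center_hom (Z W : center_ob B) := CenterHom {
  center_hom_val : hom Z W;
  center_hom_valP : center_hom_val \in @is_center_hom Z W
}.

Section CenterHomZmod.
Variables Z W : center_ob B.
HB.instance Definition _ := [isSub of center_hom Z W for @center_hom_val Z W].
HB.instance Definition _ := [Choice of center_hom Z W by <:].
Lemma is_center_hom_zmod : zmod_closed (@is_center_hom Z W).
Proof.
split=> [|f g]; rewrite !unfold_in.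
  by apply/asboolP => N; rewrite tensm0 tens0m comp0m compm0.
move=> /asboolP Ef /asboolP Eg; apply/asboolP => N.
by rewrite tensmDr tensmDl tensmN tensNm compDr compDl compNm compmN Ef Eg.
Qed.
HB.instance Definition _ :=
  GRing.isZmodClosed.Build (hom Z W) (@is_center_hom Z W) is_center_hom_zmod.
HB.instance Definition _ := [SubChoice_isSubZmodule of center_hom Z W by <:].
End CenterHomZmod.

Lemma center_homP (Z W : center_ob B) (f : hom Z W) :
  (forall N : B, (idm N ⊠ f) ∘ fwd (ce_hb Z N) =
                 fwd (ce_hb W N) ∘ (f ⊠ idm N)) -> f \in @is_center_hom Z W.
Proof. by move=> E; apply/asboolP. Qed.
Lemma center_homE (Z W : center_ob B) (f : center_hom Z W) (N : B) :
  (idm N ⊠ center_hom_val f) ∘ fwd (ce_hb Z N) =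
  fwd (ce_hb W N) ∘ (center_hom_val f ⊠ idm N).
Proof. by have /asboolP := valP f. Qed.

Lemma center_id_subproof (Z : center_ob B) :
  idm (Z : B) \in @is_center_hom Z Z.
Proof. by apply: center_homP => N; rewrite !tensm1 comp1m compm1. Qed.
Lemma center_comp_subproof (Z W V : center_ob B) (g : center_hom W V)
  (f : center_hom Z W) :
  center_hom_val g ∘ center_hom_val f \in @is_center_hom Z V.
Proof.
apply: center_homP => N.
by rewrite tens1M tensM1 -compA center_homE !compA center_homE.
Qed.

Definition center_cat : preadditive.
Proof.
apply: (@Preadditive (center_ob B) (fun Z W => center_hom Z W)
  (fun Z => CenterHom (center_id_subproof Z))
  (fun Z W V g f => CenterHom (center_comp_subproof g f))) => *;
apply: val_inj => /=.
- exact: compA.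
- exact: comp1m.
- exact: compm1.
- exact: compDl.
- exact: compDr.
Defined.

Definition cval (Z W : center_cat) (f : hom Z W) : hom (ce_ob Z) (ce_ob W) :=
  center_hom_val f.
Lemma cval_inj (Z W : center_cat) (f g : hom Z W) : cval f = cval g -> f = g.
Proof. exact: val_inj. Qed.
Lemma cvalE (Z W : center_cat) (f : hom Z W) (N : B) :
  (idm N ⊠ cval f) ∘ fwd (ce_hb Z N) = fwd (ce_hb W N) ∘ (cval f ⊠ idm N).
Proof. exact: center_homE. Qed.
Definition chom (Z W : center_cat) (f : hom (ce_ob Z) (ce_ob W))
  (E : forall N : B, (idm N ⊠ f) ∘ fwd (ce_hb Z N) =
                     fwd (ce_hb W N) ∘ (f ⊠ idm N)) : hom Z W :=
  CenterHom (center_homP E).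

Section CenterIso.
Variables (Z W : center_cat) (i : iso (ce_ob Z) (ce_ob W)).
Hypothesis E : forall N : B, (idm N ⊠ fwd i) ∘ fwd (ce_hb Z N) =
                             fwd (ce_hb W N) ∘ (fwd i ⊠ idm N).
Lemma ciso_subproof (N : B) : (idm N ⊠ bwd i) ∘ fwd (ce_hb W N) =
                              fwd (ce_hb Z N) ∘ (bwd i ⊠ idm N).
Proof.
apply: (@iso_square _ _ _ _ _ (tens_iso (iso_id N) i) (tens_iso i (iso_id N))).
by rewrite /= E.
Qed.
Lemma cisoK : (chom ciso_subproof : hom W Z) ∘ (chom E : hom Z W) = idm Z.
Proof. exact/cval_inj/(fwdK i). Qed.
Lemma cisoK' : (chom E : hom Z W) ∘ (chom ciso_subproof : hom W Z) = idm W.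
Proof. exact/cval_inj/(bwdK i). Qed.
Definition ciso : iso Z W := Iso cisoK cisoK'.
End CenterIso.

Let z (Z : center_ob B) (N t : B) : hom (Z ⊗ (N ⊗ t)) (N ⊗ (Z ⊗ t)) :=
  gen (a := WT (O (ce_ob Z)) (O N)) (b := WT (O N) (O (ce_ob Z)))
    (fwd (ce_hb Z N)) t.
Let zN (Z : center_ob B) (N t t' : B) (g : hom t t') :
  z Z N t' ∘ (idm (ce_ob Z) ⊠ (idm N ⊠ g)) =
  (idm N ⊠ (idm (ce_ob Z) ⊠ g)) ∘ z Z N t.
Proof. exact: (gen_nat (a := WT (O _) (O N)) (b := WT (O N) (O _))). Qed.
Let zT (Z : center_ob B) (N M t : B) :
  gen (a := WT (O (ce_ob Z)) (WT (O N) (O M)))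
    (b := WT (WT (O N) (O M)) (O (ce_ob Z))) (fwd (ce_hb Z (N ⊗ M))) t =
  (idm N ⊠ z Z M t) ∘ z Z N (M ⊗ t).
Proof. by flatten_in B (hb_hex (ce_hb Z) N M) t. Qed.
Let w2 (X Y Z T : B) (f : hom Z T) (g : hom Y Z) (r : hom Y T) :
  f ∘ g = r -> (idm X ⊠ f) ∘ (idm X ⊠ g) = idm X ⊠ r.
Proof. by move=> <-; rewrite tens1M. Qed.

Definition tens_hb (Z W : center_ob B) (N : B) :
    iso ((ce_ob Z ⊗ ce_ob W) ⊗ N) (N ⊗ (ce_ob Z ⊗ ce_ob W)) :=
  iso_comp (assoc N (ce_ob Z) W) (iso_comp
    (tens_iso (ce_hb Z N) (iso_id (ce_ob W))) (iso_comp
    (iso_inv (assoc (ce_ob Z) N W)) (iso_comp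
    (tens_iso (iso_id (ce_ob Z)) (ce_hb W N))
    (assoc (ce_ob Z) (ce_ob W) N)))).

Lemma tens_hb_nat (Z W : center_ob B) (N N' : B) (f : hom N N') :
  fwd (tens_hb Z W N') ∘ (idm (ce_ob Z ⊗ ce_ob W) ⊠ f) =
  (f ⊠ idm (ce_ob Z ⊗ ce_ob W)) ∘ fwd (tens_hb Z W N).
Proof.
have HZ := hb_nat (ce_hb Z) f; have HW := hb_nat (ce_hb W) f.
rewrite /=; flatten B.
flatten_in B HZ (ce_ob W ⊗ t) => HZ'; flatten_in B HW t => HW'.
by rewrite (pre2 (w2 _ HW')) tens1M ?compA HZ'.
Qed.

Lemma tens_hb_hex (Z W : center_ob B) (N M : B) :
  fwd (assoc N M (ce_ob Z ⊗ W)) ∘ fwd (tens_hb Z W (N ⊗ M))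
    ∘ fwd (assoc (ce_ob Z ⊗ W) N M) =
  (idm N ⊠ fwd (tens_hb Z W M)) ∘ fwd (assoc N (ce_ob Z ⊗ W) M)
    ∘ (fwd (tens_hb Z W N) ⊠ idm M).
Proof.
rewrite /=; flatten B; rewrite !zT ?tens1M ?compA.
by rewrite [in LHS](pre2 (zN _ _ _)) ?compA.
Qed.

Definition center_tens (Z W : center_cat) : center_cat :=
  CenterOb (HalfBraiding (@tens_hb_nat Z W) (@tens_hb_hex Z W)).

Definition unit_hb (N : B) : iso (munit ⊗ N) (N ⊗ munit) :=
  iso_comp (iso_inv (runit N)) (lunit N).

Lemma unit_hb_nat (N N' : B) (f : hom N N') :
  fwd (unit_hb N') ∘ (idm munit ⊠ f) = (f ⊠ idm munit) ∘ fwd (unit_hb N).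
Proof. by rewrite /=; flatten B. Qed.
Lemma unit_hb_hex (N M : B) :
  fwd (assoc N M munit) ∘ fwd (unit_hb (N ⊗ M)) ∘ fwd (assoc munit N M) =
  (idm N ⊠ fwd (unit_hb M)) ∘ fwd (assoc N munit M)
    ∘ (fwd (unit_hb N) ⊠ idm M).
Proof. by rewrite /=; flatten B; rewrite tensm1. Qed.

Definition center_unit : center_cat :=
  CenterOb (HalfBraiding unit_hb_nat unit_hb_hex).

Lemma center_tensm_subproof (Z Z' W W' : center_cat) (f : hom Z Z')
    (g : hom W W') (N : B) :
  (idm N ⊠ (cval f ⊠ cval g)) ∘ fwd (ce_hb (center_tens Z W) N) =
  fwd (ce_hb (center_tens Z' W') N) ∘ ((cval f ⊠ cval g) ⊠ idm N).
Proof.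
have Hf := cvalE f N; have Hg := cvalE g N.
rewrite /=; flatten B.
flatten_in B Hf (ce_ob W' ⊗ t) => Hf'; flatten_in B Hg t => Hg'.
have Gf := gen_nat (a := O (ce_ob Z)) (b := O (ce_ob Z')) (cval f).
rewrite tens1M (pre2 (esym (zN _ _ _))) ?compA Hf'.
rewrite (pre2 (w2 _ Hg')) tens1M ?compA; congr (_ ∘ _).
by rewrite (pre2 (Gf _ _ _)) ?compA.
Qed.

Definition center_tensm (Z Z' W W' : center_cat) (f : hom Z Z')
    (g : hom W W') : hom (center_tens Z W) (center_tens Z' W') :=
  @chom (center_tens Z W) (center_tens Z' W') _ (center_tensm_subproof f g).

Lemma center_assoc_subproof (Z W V : center_cat) (N : B) :
  (idm N ⊠ fwd (assoc (ce_ob Z) (ce_ob W) (ce_ob V))) ∘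
    fwd (ce_hb (center_tens (center_tens Z W) V) N) =
  fwd (ce_hb (center_tens Z (center_tens W V)) N) ∘
    (fwd (assoc (ce_ob Z) (ce_ob W) (ce_ob V)) ⊠ idm N).
Proof. by rewrite /=; flatten B; rewrite ?tens1M ?compA. Qed.

Lemma center_lunit_subproof (Z : center_cat) (N : B) :
  (idm N ⊠ fwd (lunit (ce_ob Z))) ∘ fwd (ce_hb (center_tens center_unit Z) N) =
  fwd (ce_hb Z N) ∘ (fwd (lunit (ce_ob Z)) ⊠ idm N).
Proof. by rewrite /=; flatten B. Qed.

Lemma center_runit_subproof (Z : center_cat) (N : B) :
  (idm N ⊠ fwd (runit (ce_ob Z))) ∘ fwd (ce_hb (center_tens Z center_unit) N) =
  fwd (ce_hb Z N) ∘ (fwd (runit (ce_ob Z)) ⊠ idm N).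
Proof. by rewrite /=; flatten B; rewrite ?tensm1 ?compm1. Qed.

Definition center : moncat.
Proof.
apply: (@Moncat center_cat center_tens center_tensm center_unit
  (fun X Y Z => @ciso (center_tens (center_tens X Y) Z)
     (center_tens X (center_tens Y Z)) _ (center_assoc_subproof X Y Z))
  (fun X => @ciso (center_tens center_unit X) X _ (center_lunit_subproof X))
  (fun X => @ciso (center_tens X center_unit) X _ (center_runit_subproof X)))
  => *; apply: cval_inj.
- exact: tensm1.
- exact: tensmM.
- exact: tensmDl.
- exact: tensmDr.
- exact: assoc_nat.
- exact: lunit_nat.
- exact: runit_nat.
- exact: pentagon.
- exact: triangle.
Defined.

Lemma center_br_subproof (Z W : center) (N : B) :
  (idm N ⊠ fwd (ce_hb Z (ce_ob W))) ∘ fwd (ce_hb (Z ⊗ W) N) =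
  fwd (ce_hb (W ⊗ Z) N) ∘ (fwd (ce_hb Z (ce_ob W)) ⊠ idm N).
Proof.
have H := hb_nat (ce_hb Z) (fwd (ce_hb W N)).
rewrite /=; flatten B; rewrite ?compA.
flatten_in B H t; rewrite !zT => ->.
by rewrite ?compA.
Qed.

Definition center_br (Z W : center) : iso (Z ⊗ W) (W ⊗ Z) :=
  @ciso (Z ⊗ W) (W ⊗ Z) _ (center_br_subproof Z W).

Lemma center_br_nat (Z Z' W W' : center) (f : hom Z Z') (g : hom W W') :
  fwd (center_br Z' W') ∘ (f ⊠ g) = (g ⊠ f) ∘ fwd (center_br Z W).
Proof.
apply: cval_inj; have Hf := cvalE f (ce_ob W').
have Hg := hb_nat (ce_hb Z) (cval g).
change (fwd (ce_hb Z' (ce_ob W')) ∘ (cval f ⊠ cval g) =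
        (cval g ⊠ cval f) ∘ fwd (ce_hb Z (ce_ob W))).
by rewrite tens_lr compA -Hf -compA Hg compA -tensmM comp1m compm1.
Qed.

Lemma center_br_hex1 (X Y Z : center) :
  fwd (assoc Y Z X) ∘ fwd (center_br X (Y ⊗ Z)) ∘ fwd (assoc X Y Z) =
  (idm Y ⊠ fwd (center_br X Z)) ∘ fwd (assoc Y X Z)
    ∘ (fwd (center_br X Y) ⊠ idm Z).
Proof. exact/cval_inj/(hb_hex (ce_hb X)). Qed.

Lemma center_br_hex2 (X Y Z : center) :
  bwd (assoc Z X Y) ∘ fwd (center_br (X ⊗ Y) Z) ∘ bwd (assoc X Y Z) =
  (fwd (center_br X Z) ⊠ idm Y) ∘ bwd (assoc X Z Y)
    ∘ (idm X ⊠ fwd (center_br Y Z)).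
Proof.
apply: cval_inj.
change (bwd (assoc (ce_ob Z) (ce_ob X) (ce_ob Y)) ∘ fwd (tens_hb X Y (ce_ob Z))
  ∘ bwd (assoc (ce_ob X) (ce_ob Y) (ce_ob Z)) =
  (fwd (ce_hb X (ce_ob Z)) ⊠ idm (ce_ob Y))
  ∘ bwd (assoc (ce_ob X) (ce_ob Z) (ce_ob Y))
  ∘ (idm (ce_ob X) ⊠ fwd (ce_hb Y (ce_ob Z)))).
by rewrite /=; flatten B.
Qed.

Definition center_braiding : braiding center :=
  Braiding center_br_nat center_br_hex1 center_br_hex2.

End Center.

(* The composite of a monoidal functor to the center of [B] with the strict
   monoidal forgetful functor to [B]; the half-braidings are [ce_hb (J V)]. *)
Section CenterForget.
Variables (C B : moncat) (J : monfunctor C (center B)).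

Definition cf_functor : functor C B.
Proof.
apply: (@Functor C B (fun V => ce_ob (J V)) (fun V W f => cval (fmap J f))).
- by move=> V; rewrite fmap1.
- by move=> V W U g f; rewrite fmapM.
- by move=> V W f g; rewrite fmapD.
Defined.

Definition cf_iso (Z W : center B) (i : iso Z W) : iso (ce_ob Z) (ce_ob W) :=
  Iso (congr1 (@cval B Z Z) (fwdK i)) (congr1 (@cval B W W) (bwdK i)).

Definition center_forget : monfunctor C B.
Proof.
apply: (@MonFunctor C B cf_functor).
apply: (@Monoidal C B cf_functor (fun V W => cf_iso (mfT J V W))
  (cf_iso (mfU J))).
- move=> V V' W W' f g; exact: (congr1 (@cval _ _ _) (mf_T_nat (mf_str J) f g)).
- move=> U V W; exact: (congr1 (@cval _ _ _) (mf_assoc (mf_str J) U V W)).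
- move=> V; exact: (congr1 (@cval _ _ _) (mf_lunit (mf_str J) V)).
- move=> V; exact: (congr1 (@cval _ _ _) (mf_runit (mf_str J) V)).
Defined.

End CenterForget.

(* The canonical identification of [forget (M.V)] with [forget M ⊗ V]. *)
Definition forget_T (C : moncat) (A : algebra C) (M : Rep_rmod A) (V : C) :
    iso (forget A (ract M V)) (forget A M ⊗ V) :=
  iso_id (mod_ob M ⊗ V).

(* Main.v *)
(* [l] composed with [F] is the functor forgetting the action, so for modules
   [X], [Y] the object [F X ⊗ F Y] of [B] puts an action of [A] on [X ⊗ Y], and a
   morphism of [C] that lifts to [B] is linear because [F] is full.  The
   associators and [F^T] show that the action on [X ⊗ (Y.V)] is that on
   [(X ⊗ Y).V]; the half-braidings of the objects [iota V] show that the action on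
   [(X.V) ⊗ Y] is that on [(X ⊗ Y).V] up to the braiding of [C].  As every module
   [X] is the image of the free module [A.X] under its action, the actions on all
   [X ⊗ Y] are thus determined by the action on [A ⊗ A], namely by
   [Delta h = h (1 ⊗ 1)]; the bialgebra axioms follow by evaluating on units.

   In the rigid case the modules have duals.  From a left dual of the regular
   module one gets [S h = e_i <h e^i, 1>], for which [<h f, x> = <f, S h x>] in
   every dual pair of modules; from a right dual one gets in the same way a map
   [S'] with [<x, h f> = <S' h x, f>].  Comparing the two identities shows that [S']
   is inverse to [S]. *)
From mathcomp Require Import ssreflect ssrfun ssrbool ssralg.
Require Import Defs.

Set Implicit Arguments.
Unset Strict Implicit.
Unset Printing Implicit Defensive.

Local Open Scope cat_scope.

(** * Full faithfulness of equivalences, and transport of actions along isomorphisms *)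

Section Equivalence.
Variables (C D : preadditive) (F : functor C D) (G : functor D C).
Variable gf : natiso (functor_comp G F) (functor_id C).

Lemma retract_faithful (X Y : C) (f g : hom X Y) :
  fmap F f = fmap F g -> f = g.
Proof.
move=> E; apply: (fwd_injr (i := gf X)).
by have := nat_isoE gf f; rewrite /= => <-; rewrite E -(nat_isoE gf g).
Qed.

(** The preimage is [fmap G g] conjugated with [gf], so that [G] takes [fmap F f] and [g] to the
    same morphism; [G] is faithful because of [fg]. *)
Lemma equivalence_full (fg : natiso (functor_comp F G) (functor_id D))
    (X Y : C) (g : hom (F X) (F Y)) : exists f : hom X Y, fmap F f = g.
Proof.
have Gfaithful (U V : D) (a b : hom U V) : fmap G a = fmap G b -> a = b.
  move=> E; apply: (fwd_injr (i := fg U)).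
  by have := nat_isoE fg a; rewrite /= => <-; rewrite E -(nat_isoE fg b).
exists (fwd (gf Y) ∘ fmap G g ∘ bwd (gf X)).
apply: Gfaithful; apply: (fwd_inj (i := gf Y)).
have := nat_isoE gf (fwd (gf Y) ∘ fmap G g ∘ bwd (gf X)); rewrite /= => ->.
by rewrite -compA fwdK compm1.
Qed.

End Equivalence.

Section Transport.
Variables (C : moncat) (A : algebra C) (X : Rep A) (M : C).
Variable q : iso (mod_ob X) M.
Local Notation n := (al_ob A).

(** The action is put on [M] itself because actions on one fixed object, such as
    [mod_ob X ⊗ mod_ob Y], are later compared as morphisms of [C]. *)
Definition transport_act : hom (n ⊗ M) M :=
  fwd q ∘ mod_act X ∘ (idm n ⊠ bwd q).

Lemma transport_assoc : transport_act ∘ (al_mul A ⊠ idm M) =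
  transport_act ∘ (idm n ⊠ transport_act) ∘ fwd (assoc n n M).
Proof.
rewrite /transport_act -[LHS]compA -tens_swap compA -(compA (fwd q)) mod_assoc.
rewrite -!compA -tensm1 assoc_nat !tens1M !compA; congr (_ ∘ _).
have qK : (idm n ⊠ bwd q) ∘ (idm n ⊠ fwd q) = idm _.
  by rewrite -tens1M fwdK tensm1.
by rewrite [in RHS](pre2 qK) compm1.
Qed.

Lemma transport_lunit : transport_act ∘ (al_one A ⊠ idm M) = fwd (lunit M).
Proof.
rewrite /transport_act -compA -tens_swap compA -(compA (fwd q)) mod_lunit.
by rewrite -compA lunit_nat compA bwdK comp1m.
Qed.

Definition transport_mod : Rep A := Module transport_assoc transport_lunit.

Lemma transport_linear :
  bwd q ∘ mod_act transport_mod = mod_act X ∘ (idm n ⊠ bwd q).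
Proof. by rewrite /= /transport_act !compA fwdK comp1m. Qed.

Definition transport_iso : iso transport_mod X :=
  @riso _ _ transport_mod X (iso_inv q) transport_linear.

End Transport.

(** * Linearity of the morphisms that lift to [B] *)

Section Lifting.
Variables (C B : moncat) (l : monfunctor B C) (A : algebra C).
Variables (F : functor (Rep A) B) (G : functor B (Rep A)).
Variables (gf : natiso (functor_comp G F) (functor_id (Rep A)))
          (fg : natiso (functor_comp F G) (functor_id B)).
Variable eta : natiso (functor_comp l F) (forget A).
Local Notation n := (al_ob A).

Lemma etaE (X Y : Rep A) (f : hom X Y) :
  fwd (eta Y) ∘ fmap l (fmap F f) = rval f ∘ fwd (eta X).
Proof. exact: (nat_isoE eta f). Qed.

(* An isomorphism [p : l N -> M] exhibits [M] as the underlying object of [N]. *)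
Definition over (N N' : B) (M M' : C) (p : iso (l N) M) (p' : iso (l N') M')
    (f : hom M M') (g : hom N N') : Prop :=
  f ∘ fwd p = fwd p' ∘ fmap l g.

Lemma over_comp (N N' N'' : B) (M M' M'' : C) (p : iso (l N) M)
    (p' : iso (l N') M') (p'' : iso (l N'') M'') f' g' f g :
  over p' p'' f' g' -> over p p' f g -> over p p'' (f' ∘ f) (g' ∘ g).
Proof.
by rewrite /over => E' E; rewrite -compA E compA E' -compA -fmapM.
Qed.

Lemma over_id (N : B) (M : C) (p : iso (l N) M) : over p p (idm M) (idm N).
Proof. by rewrite /over comp1m fmap1 compm1. Qed.

Lemma over_inv (N N' : B) (M M' : C) (p : iso (l N) M) (p' : iso (l N') M')
    (i : iso M M') (j : iso N N') :
  over p p' (fwd i) (fwd j) -> over p' p (bwd i) (bwd j).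
Proof.
rewrite /over => E.
by apply: (@iso_square _ _ _ _ _ i (fmap_iso l j)); rewrite /= E.
Qed.

Lemma over_eta (X Y : Rep A) (f : hom X Y) :
  over (eta X) (eta Y) (rval f) (fmap F f).
Proof. by rewrite /over etaE. Qed.

Definition tens_frame (N N' : B) (M M' : C) (p : iso (l N) M)
    (p' : iso (l N') M') : iso (l (N ⊗ N')) (M ⊗ M') :=
  iso_comp (tens_iso p p') (mfT l N N').

Lemma over_tens (N1 N1' N2 N2' : B) (M1 M1' M2 M2' : C)
    (p1 : iso (l N1) M1) (p1' : iso (l N1') M1')
    (p2 : iso (l N2) M2) (p2' : iso (l N2') M2') f1 g1 f2 g2 :
  over p1 p1' f1 g1 -> over p2 p2' f2 g2 ->
  over (tens_frame p1 p2) (tens_frame p1' p2') (f1 ⊠ f2) (g1 ⊠ g2).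
Proof.
rewrite /over /= => E1 E2; rewrite compA -tensmM E1 E2 tensmM.
by rewrite -!compA (mf_T_nat (mf_str l)).
Qed.

(** This is the axiom [mf_assoc] of [l], with the frames moved through it by naturality of the
    associator. *)
Lemma over_assoc (N1 N2 N3 : B) (M1 M2 M3 : C)
    (p1 : iso (l N1) M1) (p2 : iso (l N2) M2) (p3 : iso (l N3) M3) :
  over (tens_frame (tens_frame p1 p2) p3) (tens_frame p1 (tens_frame p2 p3))
    (fwd (assoc M1 M2 M3)) (fwd (assoc N1 N2 N3)).
Proof.
rewrite /over /=; have H := mf_assoc (mf_str l) N1 N2 N3.
have -> : fwd p1 ⊠ (fwd p2 ⊠ fwd p3 ∘ fwd (mfT l N2 N3)) =
  (fwd p1 ⊠ (fwd p2 ⊠ fwd p3)) ∘ (idm _ ⊠ fwd (mfT l N2 N3)).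
  by rewrite -tensmM compm1.
rewrite -!compA [X in _ = _ ∘ X]compA -H ?compA -assoc_nat; congr (_ ∘ _).
by rewrite -!compA; congr (_ ∘ _); rewrite -tensmM compm1.
Qed.

Lemma over_lunit (N : B) (M : C) (p : iso (l N) M) :
  over (tens_frame (mfU l) p) p (fwd (lunit M)) (fwd (lunit N)).
Proof.
rewrite /over /= -(mf_lunit (mf_str l)) tens_lr -/(mfU l).
rewrite !compA -lunit_nat -!compA; congr (_ ∘ _); rewrite !compA.
by rewrite -!tensmM !comp1m !compm1.
Qed.

Lemma over_runit (N : B) (M : C) (p : iso (l N) M) :
  over (tens_frame p (mfU l)) p (fwd (runit M)) (fwd (runit N)).
Proof.
rewrite /over /= -(mf_runit (mf_str l)) tens_lr -/(mfU l).
rewrite !compA -runit_nat -!compA.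
by congr (_ ∘ _); rewrite !compA.
Qed.

(** Up to [eta] the composite [l ∘ F] is the faithful functor [forget], and up to [fg] every
    morphism of [B] comes from a morphism of modules. *)
Lemma l_faithful (N N' : B) (g g' : hom N N') : fmap l g = fmap l g' -> g = g'.
Proof.
move=> E; apply: (retract_faithful fg); apply: rval_inj.
apply: (fwd_injr (i := eta (G N))); rewrite -!etaE; congr (_ ∘ _).
apply: (fwd_inj (i := fmap_iso l (fg N'))); rewrite /= -!fmapM.
have H := nat_isoE fg g; have H' := nat_isoE fg g'; rewrite /= in H H'.
by rewrite H H' !fmapM E.
Qed.

Lemma over_inj (N N' : B) (M M' : C) (p : iso (l N) M) (p' : iso (l N') M')
    (f : hom M M') (g g' : hom N N') :
  over p p' f g -> over p p' f g' -> g = g'.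
Proof.
rewrite /over => -> E; apply: l_faithful; exact: (fwd_inj (i := p')).
Qed.

(** Reduces the commutativity of a diagram in [B] to that of the diagram of [C] under it. *)
Lemma over_eq (N N' : B) (M M' : C) (p : iso (l N) M) (p' : iso (l N') M')
    (f f' : hom M M') (g g' : hom N N') :
  over p p' f g -> over p p' f' g' -> f = f' -> g = g'.
Proof. by move=> E E' Ef; subst f'; apply: over_inj E E'. Qed.

(** As [Phi] lies over the identity, [N] with its frame [p] fixes the action of [X] itself and not
    only its isomorphism class. *)
Definition realizes (X : Rep A) (N : B) (p : iso (l N) (mod_ob X)) : Prop :=
  exists Phi : iso (F X) N, over (eta X) p (idm (mod_ob X)) (fwd Phi).

Lemma realizes_eta (X : Rep A) : realizes (eta X).
Proof. exists (iso_id (F X)); exact: over_id. Qed.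

(* [F] is full, so a morphism of [C] that comes from [B] is [A]-linear. *)
Lemma over_linear (X X' : Rep A) (N N' : B) (p : iso (l N) (mod_ob X))
    (p' : iso (l N') (mod_ob X')) (f : hom (mod_ob X) (mod_ob X'))
    (g : hom N N') :
  realizes p -> realizes p' -> over p p' f g ->
  f ∘ mod_act X = mod_act X' ∘ (idm n ⊠ f).
Proof.
move=> [Phi EPhi] [Phi' EPhi'] E.
have [h Eh] := equivalence_full gf fg (bwd Phi' ∘ (g ∘ fwd Phi)).
suff -> : f = rval h by exact: rvalE.
apply: (fwd_injr (i := eta X)); rewrite -etaE Eh.
have EPhi'' := @over_inv _ _ _ _ _ _ (iso_id (mod_ob X')) Phi' EPhi'.
have := over_comp EPhi'' (over_comp E EPhi).
by rewrite /over compm1 comp1m.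
Qed.

Section Lift.
Variables (N : B) (M : C) (p : iso (l N) M).

Let q : iso (mod_ob (G N)) M :=
  iso_comp p (iso_comp (fmap_iso l (fg N)) (iso_inv (eta (G N)))).

(** The action that [N] puts on the object [M] under it, transported from the module [G N]. *)
Definition lift : Rep A := transport_mod q.

Definition lift_iso : iso (F lift) N :=
  iso_comp (fg N) (fmap_iso F (transport_iso q)).

Lemma lift_isoP : over (eta lift) p (idm M) (fwd lift_iso).
Proof.
(* This is [etaE] at [transport_iso q], whose underlying morphism is [bwd q] by conversion. *)
have E : fwd (eta (G N)) ∘ fmap l (fmap F (fwd (transport_iso q))) =
  bwd q ∘ fwd (eta lift) := etaE _.
rewrite /over comp1m /lift_iso; move: (transport_iso q) E => i E.
apply: (fwd_inj (i := iso_inv q)); rewrite -[LHS]E {E} /= fmapM -!compA.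
by rewrite (compA (bwd p)) fwdK comp1m (compA (fmap l (bwd _))) -fmapM fwdK
  fmap1 comp1m.
Qed.

Lemma realizes_lift : @realizes lift N p.
Proof. by exists lift_iso; exact: lift_isoP. Qed.
End Lift.

End Lifting.

(** * Bialgebras from natural tensor products of modules *)

Definition regular (C : moncat) (A : algebra C) : Rep A :=
  Module (al_assoc A) (al_lunit A).

Lemma id_tensM (C : moncat) (X Y Z T : C) (f : hom Z T) (g : hom Y Z) (r : hom Y T) :
  f ∘ g = r -> (idm X ⊠ f) ∘ (idm X ⊠ g) = idm X ⊠ r.
Proof. by move=> <-; rewrite tens1M. Qed.

(* [gen_nat] with the word maps evaluated; the digits count the objects in the
   source and the target. *)
Section GenNat.
Variables (C : moncat) (X Y Z W t t' : C) (g : hom t t').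
Local Notation O := (@WO C).

Lemma gen_nat01 (f : hom munit X) :
  gen (a := @WI C) (b := O X) f t' ∘ g =
  (idm X ⊠ g) ∘ gen (a := @WI C) (b := O X) f t.
Proof. exact: (gen_nat (a := @WI C) (b := O X)). Qed.
Lemma gen_nat10 (f : hom X munit) :
  gen (a := O X) (b := @WI C) f t' ∘ (idm X ⊠ g) =
  g ∘ gen (a := O X) (b := @WI C) f t.
Proof. exact: (gen_nat (a := O X) (b := @WI C)). Qed.
Lemma gen_nat11 (f : hom X Y) :
  gen (a := O X) (b := O Y) f t' ∘ (idm X ⊠ g) =
  (idm Y ⊠ g) ∘ gen (a := O X) (b := O Y) f t.
Proof. exact: (gen_nat (a := O X) (b := O Y)). Qed.
Lemma gen_nat21 (f : hom (X ⊗ Y) Z) :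
  gen (a := WT (O X) (O Y)) (b := O Z) f t' ∘ (idm X ⊠ (idm Y ⊠ g)) =
  (idm Z ⊠ g) ∘ gen (a := WT (O X) (O Y)) (b := O Z) f t.
Proof. exact: (gen_nat (a := WT (O X) (O Y)) (b := O Z)). Qed.
Lemma gen_nat12 (f : hom X (Y ⊗ Z)) :
  gen (a := O X) (b := WT (O Y) (O Z)) f t' ∘ (idm X ⊠ g) =
  (idm Y ⊠ (idm Z ⊠ g)) ∘ gen (a := O X) (b := WT (O Y) (O Z)) f t.
Proof. exact: (gen_nat (a := O X) (b := WT (O Y) (O Z))). Qed.
Lemma gen_nat20 (f : hom (X ⊗ Y) munit) :
  gen (a := WT (O X) (O Y)) (b := @WI C) f t' ∘ (idm X ⊠ (idm Y ⊠ g)) =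
  g ∘ gen (a := WT (O X) (O Y)) (b := @WI C) f t.
Proof. exact: (gen_nat (a := WT (O X) (O Y)) (b := @WI C)). Qed.
Lemma gen_nat02 (f : hom munit (X ⊗ Y)) :
  gen (a := @WI C) (b := WT (O X) (O Y)) f t' ∘ g =
  (idm X ⊠ (idm Y ⊠ g)) ∘ gen (a := @WI C) (b := WT (O X) (O Y)) f t.
Proof. exact: (gen_nat (a := @WI C) (b := WT (O X) (O Y))). Qed.
End GenNat.

(** * Orbit maps of points of modules *)

Section Orbit.
Variables (C : moncat) (A : algebra C).
Local Notation n := (al_ob A).

(** In elements [h ↦ h x]. The bialgebra axioms are obtained by comparing such maps for points built
    from units. *)
Definition orbit (X : Rep A) (x : hom munit (mod_ob X)) : hom n (mod_ob X) :=
  mod_act X ∘ (idm n ⊠ x) ∘ bwd (runit n).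
Arguments orbit X x : clear implicits.

Lemma orbit_regular : orbit (regular A) (al_one A) = idm n.
Proof. by rewrite /orbit /= al_runit bwdK. Qed.

Lemma orbit_linear (X Y : Rep A) (f : hom (mod_ob X) (mod_ob Y))
    (x : hom munit (mod_ob X)) :
  f ∘ mod_act X = mod_act Y ∘ (idm n ⊠ f) -> f ∘ orbit X x = orbit Y (f ∘ x).
Proof. by move=> E; rewrite /orbit !compA E -(compA (mod_act Y)) -tens1M. Qed.

Lemma orbit_one (X : Rep A) (x : hom munit (mod_ob X)) :
  orbit X x ∘ al_one A = x.
Proof.
have H := mod_lunit X.
rewrite /orbit; flatten C; flatten_in C H t => {}H.
by rewrite (pre2 (esym (gen_nat01 _ _))) ?compA H comp1m.
Qed.

Lemma orbit_mul (X : Rep A) (x : hom munit (mod_ob X)) :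
  orbit X x ∘ al_mul A = mod_act X ∘ (idm n ⊠ orbit X x).
Proof.
have H := mod_assoc X.
rewrite /orbit; flatten C; flatten_in C H t => {}H.
by rewrite (pre2 (esym (gen_nat21 _ _))) ?compA H !tens1M !compA.
Qed.

End Orbit.

Arguments orbit {C A} X x.

Section Reconstruction.
Variables (C : moncat) (c : braiding C) (A : algebra C).
Local Notation n := (al_ob A).
Local Notation O := (@WO C).
Local Notation c_ := (gbr c).
Local Notation R := (regular A).

Variable a : forall X Y : Rep A,
  hom (n ⊗ (mod_ob X ⊗ mod_ob Y)) (mod_ob X ⊗ mod_ob Y).
Hypothesis tensor_act_assoc : forall X Y : Rep A,
  a X Y ∘ (al_mul A ⊠ idm (mod_ob X ⊗ mod_ob Y)) =
  a X Y ∘ (idm n ⊠ a X Y) ∘ fwd (assoc n n (mod_ob X ⊗ mod_ob Y)).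
Hypothesis tensor_act_lunit : forall X Y : Rep A,
  a X Y ∘ (al_one A ⊠ idm (mod_ob X ⊗ mod_ob Y)) =
  fwd (lunit (mod_ob X ⊗ mod_ob Y)).
Hypothesis tensor_act_nat : forall (X X' Y Y' : Rep A) (f : hom X X') (g : hom Y Y'),
  (rval f ⊠ rval g) ∘ a X Y = a X' Y' ∘ (idm n ⊠ (rval f ⊠ rval g)).

(* [a] at [dot X V], typed with the product [mod_ob X ⊗ V] in place of
   [mod_ob (dot X V)], which [flatten] would take for an atom. *)
Definition dotl (X Y : Rep A) (V : C) :
    hom (n ⊗ ((mod_ob X ⊗ V) ⊗ mod_ob Y)) ((mod_ob X ⊗ V) ⊗ mod_ob Y) :=
  a (dot X V) Y.
Definition dotlr (X Y : Rep A) (V W : C) :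
    hom (n ⊗ ((mod_ob X ⊗ V) ⊗ (mod_ob Y ⊗ W)))
        ((mod_ob X ⊗ V) ⊗ (mod_ob Y ⊗ W)) :=
  a (dot X V) (dot Y W).

(** The factor after the associator on the left is the action on [(X ⊗ Y).V], so this is linearity
    of the associator to [X ⊗ (Y.V)]. *)
Hypothesis tensor_act_dotr : forall (X Y : Rep A) (V : C),
  fwd (assoc (mod_ob X) (mod_ob Y) V) ∘
    ((a X Y ⊠ idm V) ∘ bwd (assoc n (mod_ob X ⊗ mod_ob Y) V)) =
  a X (dot Y V) ∘ (idm n ⊠ fwd (assoc (mod_ob X) (mod_ob Y) V)).

(** The comparison of [(X ⊗ Y).V] with [(X.V) ⊗ Y], in which [V] passes [Y] by the braiding. *)
Definition swapr (X Y V : C) : hom ((X ⊗ Y) ⊗ V) ((X ⊗ V) ⊗ Y) :=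
  bwd (assoc X V Y) ∘ (idm X ⊠ fwd (c Y V)) ∘ fwd (assoc X Y V).

Hypothesis tensor_act_dotl : forall (X Y : Rep A) (V : C),
  swapr (mod_ob X) (mod_ob Y) V ∘
    ((a X Y ⊠ idm V) ∘ bwd (assoc n (mod_ob X ⊗ mod_ob Y) V)) =
  a (dot X V) Y ∘ (idm n ⊠ swapr (mod_ob X) (mod_ob Y) V).

Let ga X Y t : hom (n ⊗ (mod_ob X ⊗ (mod_ob Y ⊗ t))) (mod_ob X ⊗ (mod_ob Y ⊗ t)) :=
  gen (a := WT (O n) (WT (O (mod_ob X)) (O (mod_ob Y))))
      (b := WT (O (mod_ob X)) (O (mod_ob Y))) (a X Y) t.
Let gl X Y V t :=
  gen (a := WT (O n) (WT (WT (O (mod_ob X)) (O V)) (O (mod_ob Y))))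
      (b := WT (WT (O (mod_ob X)) (O V)) (O (mod_ob Y))) (dotl X Y V) t.
Let glr X Y V W t :=
  gen (a := WT (O n) (WT (WT (O (mod_ob X)) (O V)) (WT (O (mod_ob Y)) (O W))))
      (b := WT (WT (O (mod_ob X)) (O V)) (WT (O (mod_ob Y)) (O W)))
  (dotlr X Y V W) t.
Let gu t : hom t (n ⊗ t) := gen (a := @WI C) (b := O n) (al_one A) t.
Let gact (X : module A) t : hom (n ⊗ (mod_ob X ⊗ t)) (mod_ob X ⊗ t) :=
  gen (a := WT (O n) (O (mod_ob X))) (b := O (mod_ob X)) (mod_act X) t.
Let guN t t' (g : hom t t') : gu t' ∘ g = (idm n ⊠ g) ∘ gu t.
Proof. exact: (gen_nat (a := @WI C) (b := O n)). Qed.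
Let gau X t : gact X t ∘ gu (mod_ob X ⊗ t) = idm _.
Proof. by flatten_in C (mod_lunit X) t. Qed.
Let cNu (X : C) t : c_ n X t ∘ gu (X ⊗ t) = idm X ⊠ gu t.
Proof.
have H := br_nat c (al_one A) (idm X).
by flatten_in C H t; rewrite gen_Ibr compm1.
Qed.

Lemma glE X Y V t : gl X Y V t ∘ (idm n ⊠ (idm (mod_ob X) ⊠ c_ (mod_ob Y) V t))
   = (idm (mod_ob X) ⊠ c_ (mod_ob Y) V t) ∘ ga X Y (V ⊗ t).
Proof.
have H := tensor_act_dotl X Y V; rewrite /swapr -/(dotl X Y V) in H.
by flatten_in C H t => <-.
Qed.

(** This is [tensor_act_dotr] for the module [X.V]; flattening turns its associators into
    identities. *)
Lemma glrE X Y V W t : glr X Y V W t = gl X Y V (W ⊗ t).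
Proof.
have H := @tensor_act_dotr (dot X V) Y W.
change (fwd (assoc (mod_ob X ⊗ V) (mod_ob Y) W) ∘
    ((dotl X Y V ⊠ idm W) ∘ bwd (assoc n ((mod_ob X ⊗ V) ⊗ mod_ob Y) W)) =
  dotlr X Y V W ∘ (idm n ⊠ fwd (assoc (mod_ob X ⊗ V) (mod_ob Y) W))) in H.
by flatten_in C H t => {}H; exact: esym H.
Qed.

Lemma act_linear (X : Rep A) : mod_act X ∘ mod_act (dot R (mod_ob X)) =
  mod_act X ∘ (idm n ⊠ mod_act X).
Proof.
by apply: (fwd_injr (i := assoc n n (mod_ob X))); rewrite /= /dot_act /= -!compA
  fwdK compm1 mod_assoc compA.
Qed.

Definition act_hom (X : Rep A) : hom (dot R (mod_ob X)) X :=
  @rhom _ _ (dot R (mod_ob X)) X (mod_act X) (act_linear X).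

Definition rec_comul : hom n (n ⊗ n) :=
  a R R ∘ (idm n ⊠ ((al_one A ⊠ al_one A) ∘ bwd (lunit munit))) ∘
  bwd (runit n).

(** Naturality along the two maps [act_hom] passes to [(A.X) ⊗ (A.Y)], where [glrE] and [glE]
    express the action by the one on [A ⊗ A] and a braiding. Evaluation at [1 ⊗ x] and [1 ⊗ y] gives
    the formula. *)
Lemma rec_actE (X Y : Rep A) : a X Y =
  (mod_act X ⊠ mod_act Y) ∘ mid4 c n n (mod_ob X) (mod_ob Y) ∘
  (rec_comul ⊠ idm (mod_ob X ⊗ mod_ob Y)).
Proof.
have H := tensor_act_nat (act_hom X) (act_hom Y).
change ((mod_act X ⊠ mod_act Y) ∘ dotlr R R (mod_ob X) (mod_ob Y) =
  a X Y ∘ (idm n ⊠ (mod_act X ⊠ mod_act Y))) in H.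
rewrite /rec_comul /mid4; flatten C.
flatten_in C H t => {}H.
have El : (idm n ⊠ c_ n (mod_ob X) (mod_ob Y ⊗ t)) ∘
    ga R R (mod_ob X ⊗ mod_ob Y ⊗ t) =
  glr R R (mod_ob X) (mod_ob Y) t ∘
    (idm n ⊠ (idm n ⊠ c_ n (mod_ob X) (mod_ob Y ⊗ t))).
  by rewrite glrE; exact: esym (glE R R _ _).
rewrite (pre2 El) ?compA H -!compA -!tens1M !compA.
(* Two units are inserted, the second is braided past [X], and each then acts as the identity. *)
have E : gact X (mod_ob Y ⊗ t) ∘ (idm n ⊠ (idm (mod_ob X) ⊠ gact Y t))
    ∘ (idm n ⊠ c_ n (mod_ob X) (mod_ob Y ⊗ t)) ∘ gu _
    ∘ gu (mod_ob X ⊗ mod_ob Y ⊗ t) = idm _.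
  rewrite (pre2 (esym (guN (c_ n (mod_ob X) _)))) ?compA (pre2 (cNu _ _)).
  rewrite (pre2 (esym (guN (idm (mod_ob X) ⊠ gact Y t)))) ?compA gau comp1m.
  by rewrite -tens1M gau tensm1.
rewrite -[LHS]compm1; congr (_ ∘ _).
by rewrite -[LHS]tensm1 -E -!compA; congr (_ ⊠ _).
Qed.

Definition rec_mod (X Y : Rep A) : Rep A :=
  Module (tensor_act_assoc X Y) (tensor_act_lunit X Y).

(** In elements [h (x ⊗ y) = h_1 x ⊗ h_2 y]: in [rec_actE] the braiding moves [h_2] past the point
    [x], which is trivial by naturality and the triviality of braidings with the unit. *)
Lemma orbit_tens (X Y : Rep A) (x : hom munit (mod_ob X))
    (y : hom munit (mod_ob Y)) :
  orbit (rec_mod X Y) ((x ⊠ y) ∘ bwd (lunit munit)) =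
  (orbit X x ⊠ orbit Y y) ∘ rec_comul.
Proof.
have H := br_nat c (idm n) x.
rewrite /orbit [mod_act _]/= rec_actE /mid4.
move: rec_comul => D; flatten C.
flatten_in C H (mod_ob Y ⊗ t); rewrite gen_brI compm1 => Hx.
rewrite !tens1M ?compA (pre2 (gen_nat12 _ _)) ?compA.
rewrite [in LHS](pre2 (id_tensM n Hx)) ?compA.
rewrite (pre2 (gen_nat12 _ _)) ?compA.
congr (_ ∘ _); rewrite -!compA; congr (_ ∘ _).
rewrite -!tens1M; congr (_ ⊠ _).
by rewrite [in RHS]gen_nat01 gen_nat01 [in RHS]tens1M compA.
Qed.

(** * The bialgebra axioms from the coherence of the tensor product *)

Variable e : hom (n ⊗ munit) munit.
Hypothesis e_assoc : e ∘ (al_mul A ⊠ idm munit) =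
  e ∘ (idm n ⊠ e) ∘ fwd (assoc n n munit).
Hypothesis e_lunit : e ∘ (al_one A ⊠ idm munit) = fwd (lunit munit).
Let U : Rep A := Module e_assoc e_lunit.
Local Notation T := rec_mod.
Hypothesis rec_assoc : forall X Y Z : Rep A,
  fwd (assoc (mod_ob X) (mod_ob Y) (mod_ob Z)) ∘ mod_act (T (T X Y) Z) =
  mod_act (T X (T Y Z)) ∘
  (idm n ⊠ fwd (assoc (mod_ob X) (mod_ob Y) (mod_ob Z))).
Hypothesis rec_lunit : forall X : Rep A,
  fwd (lunit (mod_ob X)) ∘ mod_act (T U X) =
  mod_act X ∘ (idm n ⊠ fwd (lunit (mod_ob X))).
Hypothesis rec_runit : forall X : Rep A,
  fwd (runit (mod_ob X)) ∘ mod_act (T X U) =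
  mod_act X ∘ (idm n ⊠ fwd (runit (mod_ob X))).

Definition rec_counit : hom n munit := e ∘ bwd (runit n).

Lemma orbit_unit : orbit U (idm munit) = rec_counit.
Proof. by rewrite /orbit tensm1 compm1. Qed.

Let uu := (al_one A ⊠ al_one A) ∘ bwd (lunit munit).

Lemma orbit_comul : orbit (T R R) uu = rec_comul.
Proof. by []. Qed.

(** The associator is linear and takes [(1 ⊗ 1) ⊗ 1] to [1 ⊗ (1 ⊗ 1)]; [orbit_tens] computes the
    orbits of both points. *)
Lemma rec_coassoc : fwd (assoc n n n) ∘ (rec_comul ⊠ idm n) ∘ rec_comul =
  (idm n ⊠ rec_comul) ∘ rec_comul.
Proof.
have H := @orbit_linear _ _ (T (T R R) R) (T R (T R R)) _
  ((uu ⊠ al_one A) ∘ bwd (lunit munit)) (rec_assoc R R R).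
rewrite orbit_tens orbit_comul orbit_regular in H.
rewrite -compA [LHS]H.
have := @orbit_tens R (T R R) (al_one A) uu.
rewrite orbit_regular orbit_comul => <-.
congr (orbit (T R (T R R)) _).
by rewrite /uu; flatten C.
Qed.

(** Here the linear unitor is applied to the orbit of [1 ⊗ 1] in the product of the unit module and
    the regular module. *)
Lemma rec_counitl : fwd (lunit n) ∘ (rec_counit ⊠ idm n) ∘ rec_comul = idm n.
Proof.
have H := @orbit_linear _ _ (T U R) R _
  ((idm munit ⊠ al_one A) ∘ bwd (lunit munit)) (rec_lunit R).
rewrite orbit_tens orbit_unit orbit_regular in H.
rewrite -compA [LHS]H -orbit_regular; congr (orbit R _).
by flatten C.
Qed.

Lemma rec_counitr : fwd (runit n) ∘ (idm n ⊠ rec_counit) ∘ rec_comul = idm n.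
Proof.
have H := @orbit_linear _ _ (T R U) R _
  ((al_one A ⊠ idm munit) ∘ bwd (lunit munit)) (rec_runit R).
rewrite orbit_tens orbit_unit orbit_regular in H.
rewrite -compA [LHS]H -orbit_regular; congr (orbit R _).
by flatten C.
Qed.

(** In elements [(h k) (1 ⊗ 1) = h (k (1 ⊗ 1))], with the outer action computed by [rec_actE]. *)
Lemma rec_comul_mul : rec_comul ∘ al_mul A =
  (al_mul A ⊠ al_mul A) ∘ mid4 c n n n n ∘ (rec_comul ⊠ rec_comul).
Proof.
have := @orbit_mul _ _ (T R R) uu; rewrite orbit_comul => H.
rewrite [LHS]H [mod_act _]/= rec_actE.
by rewrite (tens_lr rec_comul rec_comul) [RHS]compA.
Qed.

Lemma rec_comul_one : rec_comul ∘ al_one A =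
  (al_one A ⊠ al_one A) ∘ bwd (lunit munit).
Proof. exact: (@orbit_one _ _ (T R R) uu). Qed.

Lemma rec_counit_mul : rec_counit ∘ al_mul A =
  fwd (lunit munit) ∘ (rec_counit ⊠ rec_counit).
Proof.
have := @orbit_mul _ _ U (idm munit); rewrite orbit_unit => H.
by rewrite [LHS]H /rec_counit /=; flatten C.
Qed.

Lemma rec_counit_one : rec_counit ∘ al_one A = idm munit.
Proof. by have := @orbit_one _ _ U (idm munit); rewrite orbit_unit. Qed.

Definition rec_bialgebra : bialgebra c A :=
  Bialgebra rec_coassoc rec_counitl rec_counitr rec_comul_mul rec_comul_one
    rec_counit_mul rec_counit_one.

Lemma rec_tens_act (X Y : Rep A) : a X Y = mod_act (tens_mod rec_bialgebra X Y).
Proof. exact: rec_actE. Qed.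

Lemma rec_unit_act : e = mod_act (unit_mod rec_bialgebra).
Proof. by rewrite /= /rec_counit; flatten C. Qed.

End Reconstruction.

(** * The tensor structure transported along [F] *)

Section TensorStructure.
Variables (C B : moncat) (c : braiding C) (J : monfunctor C (center B)).
Variable l : monfunctor B C.
Variable theta :
  monnatiso (monfunctor_comp l (center_forget J)) (monfunctor_id C).
Hypothesis l_half_braiding : forall (V : C) (N : B),
  (idm (l N) ⊠ fwd (theta V)) ∘ fwd (mfT l N (center_forget J V))
    ∘ fmap l (fwd (ce_hb (J V) N)) =
  bwd (c (l N) V) ∘ (fwd (theta V) ⊠ idm (l N))
    ∘ fwd (mfT l (center_forget J V) N).
Variables (A : algebra C) (F : functor (Rep A) B) (G : functor B (Rep A)).
Variables (gf : natiso (functor_comp G F) (functor_id (Rep A)))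
          (fg : natiso (functor_comp F G) (functor_id B)).
Variable eta : natiso (functor_comp l F) (forget A).
Variable FT : @module_functor C (Rep_rmod A) (res_rmod (center_forget J)) F.
Hypothesis l_FT : forall (M : Rep_rmod A) (V : C),
  (fwd (eta M) ⊠ fwd (theta V)) ∘ fwd (mfT l (F M) (center_forget J V))
    ∘ fmap l (fwd (mo_T FT M V)) =
  fwd (forget_T M V) ∘ fwd (eta (ract M V)).
Local Notation n := (al_ob A).

(** Retypes the component of [theta] so that it serves as a frame for [ce_ob (J V)]. *)
Definition theta_frame (V : C) : iso (l (ce_ob (J V))) V := theta V.

(** The hypothesis [l_half_braiding] for a general frame [p], by naturality of the inverse
    braiding. *)
Lemma over_braiding (V : C) (N : B) (M : C) (p : iso (l N) M) :
  over (tens_frame (theta_frame V) p) (tens_frame p (theta_frame V))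
    (bwd (c M V)) (fwd (ce_hb (J V) N)).
Proof.
have H : (fwd p ⊠ idm V) ∘ bwd (c (l N) V) = bwd (c M V) ∘ (idm V ⊠ fwd p).
  by have := rev_nat c (idm V) (fwd p).
have L : (idm (l N) ⊠ fwd (theta_frame V)) ∘ fwd (mfT l N (ce_ob (J V)))
    ∘ fmap l (fwd (ce_hb (J V) N)) =
  bwd (c (l N) V) ∘ (fwd (theta_frame V) ⊠ idm (l N))
    ∘ fwd (mfT l (ce_ob (J V)) N) := l_half_braiding V N.
have E1 : fwd (theta_frame V) ⊠ fwd p =
    (idm V ⊠ fwd p) ∘ (fwd (theta_frame V) ⊠ idm (l N)).
  by rewrite -tensmM compm1 comp1m.
have E2 : fwd p ⊠ fwd (theta_frame V) =
    (fwd p ⊠ idm V) ∘ (idm (l N) ⊠ fwd (theta_frame V)).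
  by rewrite -tensmM compm1 comp1m.
rewrite /over /= E1 E2 -!compA; rewrite -!compA in L; rewrite L.
by rewrite !compA H.
Qed.

(** The braiding in [swapr] is covered by the inverse of a half-braiding. Existence of [g] is all
    that [over_linear] asks for. *)
Lemma over_swapr (V : C) (N N' : B) (M M' : C) (p : iso (l N) M)
    (p' : iso (l N') M') :
  exists g, over (tens_frame (tens_frame p p') (theta_frame V))
    (tens_frame (tens_frame p (theta_frame V)) p') (swapr c M M' V) g.
Proof.
have Hb : over (tens_frame p' (theta_frame V)) (tens_frame (theta_frame V) p')
    (fwd (c M' V)) (bwd (ce_hb (J V) N')).
  exact: (@over_inv _ _ _ _ _ _ _ _ _ (iso_inv (c M' V))) (over_braiding V p').
have Ha := @over_inv _ _ _ _ _ _ _ _ _ (assoc _ _ _) (assoc _ _ _)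
  (over_assoc p (theta_frame V) p').
eexists; apply: over_comp (over_assoc p p' (theta_frame V)).
exact: (over_comp Ha (over_tens (over_id p) Hb)).
Qed.

Local Notation T X Y := (lift fg eta (tens_frame (eta X) (eta Y))).

Lemma realizes_tens (X Y : Rep A) (N N' : B) (p : iso (l N) (mod_ob X))
    (p' : iso (l N') (mod_ob Y)) :
  realizes eta p -> realizes eta p' ->
  @realizes _ _ _ _ _ eta (T X Y) _ (tens_frame p p').
Proof.
move=> [Phi EPhi] [Phi' EPhi'].
have [Psi EPsi] := realizes_lift fg eta (tens_frame (eta X) (eta Y)).
exists (iso_comp (tens_iso Phi Phi') Psi).
have := over_comp (over_tens EPhi EPhi') EPsi.
by rewrite /over tensm1 comp1m.
Qed.

(** The hypothesis [l_FT] says that [FT] lies over the identity. *)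
Lemma realizes_dot (X : Rep A) (V : C) (N : B) (p : iso (l N) (mod_ob X)) :
  realizes eta p ->
  @realizes _ _ _ _ _ eta (dot X V) _ (tens_frame p (theta_frame V)).
Proof.
move=> [Phi EPhi].
have E : over (eta (dot X V)) (tens_frame (eta X) (theta_frame V))
    (idm (mod_ob X ⊗ V)) (fwd (mo_T FT X V)).
  exact: esym (l_FT X V).
exists (iso_comp (tens_iso Phi (iso_id _)) (mo_T FT X V)).
have := over_comp (over_tens EPhi (over_id (theta_frame V))) E.
by rewrite /over tensm1 comp1m.
Qed.

Let a (X Y : Rep A) : hom (n ⊗ (mod_ob X ⊗ mod_ob Y)) (mod_ob X ⊗ mod_ob Y) :=
  mod_act (T X Y).
Let U : Rep A := lift fg eta (mfU l).
Let rT X Y := realizes_lift fg eta (tens_frame (eta X) (eta Y)).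
Let rE := realizes_eta eta.

(** This and the following linearity lemmas apply [over_linear] to a morphism of [C] that is covered
    by one of [B]. *)
Lemma tensor_act_nat (X X' Y Y' : Rep A) (f : hom X X') (g : hom Y Y') :
  (rval f ⊠ rval g) ∘ a X Y = a X' Y' ∘ (idm n ⊠ (rval f ⊠ rval g)).
Proof.
apply: (over_linear gf fg (rT X Y) (rT X' Y')).
exact: over_tens (over_eta eta f) (over_eta eta g).
Qed.

Lemma tensor_act_dotr (X Y : Rep A) (V : C) :
  fwd (assoc (mod_ob X) (mod_ob Y) V) ∘
    ((a X Y ⊠ idm V) ∘ bwd (assoc n (mod_ob X ⊗ mod_ob Y) V)) =
  a X (dot Y V) ∘ (idm n ⊠ fwd (assoc (mod_ob X) (mod_ob Y) V)).
Proof.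
exact: (over_linear gf fg (realizes_dot V (rT X Y))
  (realizes_tens (rE X) (realizes_dot V (rE Y)))
  (over_assoc (eta X) (eta Y) (theta_frame V))).
Qed.

Lemma tensor_act_dotl (X Y : Rep A) (V : C) :
  swapr c (mod_ob X) (mod_ob Y) V ∘
    ((a X Y ⊠ idm V) ∘ bwd (assoc n (mod_ob X ⊗ mod_ob Y) V)) =
  a (dot X V) Y ∘ (idm n ⊠ swapr c (mod_ob X) (mod_ob Y) V).
Proof.
have [g E] := over_swapr V (eta X) (eta Y).
exact: (over_linear gf fg (realizes_dot V (rT X Y))
  (realizes_tens (realizes_dot V (rE X)) (rE Y)) E).
Qed.

Let rU := realizes_lift fg eta (mfU l).

Lemma tensor_act_assoc_linear (X Y Z : Rep A) :
  fwd (assoc (mod_ob X) (mod_ob Y) (mod_ob Z)) ∘ mod_act (T (T X Y) Z) =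
  mod_act (T X (T Y Z)) ∘
  (idm n ⊠ fwd (assoc (mod_ob X) (mod_ob Y) (mod_ob Z))).
Proof.
exact: (over_linear gf fg (realizes_tens (rT X Y) (rE Z))
  (realizes_tens (rE X) (rT Y Z)) (over_assoc (eta X) (eta Y) (eta Z))).
Qed.

Lemma tensor_act_lunit_linear (X : Rep A) :
  fwd (lunit (mod_ob X)) ∘ mod_act (T U X) =
  mod_act X ∘ (idm n ⊠ fwd (lunit (mod_ob X))).
Proof.
exact: (over_linear gf fg (realizes_tens rU (rE X)) (rE X) (over_lunit (eta X))).
Qed.

Lemma tensor_act_runit_linear (X : Rep A) :
  fwd (runit (mod_ob X)) ∘ mod_act (T X U) =
  mod_act X ∘ (idm n ⊠ fwd (runit (mod_ob X))).
Proof.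
exact: (over_linear gf fg (realizes_tens (rE X) rU) (rE X) (over_runit (eta X))).
Qed.

Definition transported_bialgebra : bialgebra c A :=
  @rec_bialgebra C c A a (fun X Y => mod_assoc (T X Y))
    (fun X Y => mod_lunit (T X Y)) tensor_act_nat tensor_act_dotr
    tensor_act_dotl (mod_act U) (mod_assoc U) (mod_lunit U)
    tensor_act_assoc_linear tensor_act_lunit_linear tensor_act_runit_linear.

Local Notation b := transported_bialgebra.

(** The two modules are different terms whose actions agree by [rec_tens_act], so the identity of
    [C] becomes an isomorphism between them. *)
Lemma mf_T_linear (X Y : Rep A) :
  idm (mod_ob X ⊗ mod_ob Y) ∘ mod_act (tens_mod b X Y) =
  mod_act (T X Y) ∘ (idm n ⊠ idm (mod_ob X ⊗ mod_ob Y)).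
Proof. by rewrite comp1m tensm1 compm1 -rec_tens_act. Qed.

Lemma mf_U_linear :
  idm munit ∘ mod_act (unit_mod b) = mod_act U ∘ (idm n ⊠ idm munit).
Proof. by rewrite comp1m tensm1 compm1 -rec_unit_act. Qed.

Definition F_T (X Y : Rep A) : iso (F (tens_mod b X Y)) (F X ⊗ F Y) :=
  iso_comp (lift_iso fg eta (tens_frame (eta X) (eta Y)))
    (fmap_iso F (@riso _ _ (tens_mod b X Y) (T X Y) (iso_id _) (mf_T_linear X Y))).

Definition F_U : iso (F (unit_mod b)) munit :=
  iso_comp (lift_iso fg eta (mfU l))
    (fmap_iso F (@riso _ _ (unit_mod b) U (iso_id _) mf_U_linear)).

Lemma over_F_T (X Y : Rep A) : over (eta (tens_mod b X Y))
  (tens_frame (eta X) (eta Y)) (idm (mod_ob X ⊗ mod_ob Y)) (fwd (F_T X Y)).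
Proof.
have := over_comp (lift_isoP fg eta (tens_frame (eta X) (eta Y)))
  (over_eta eta (fwd (@riso _ _ (tens_mod b X Y) (T X Y) (iso_id _) (mf_T_linear X Y)))).
by rewrite /over comp1m.
Qed.

Lemma over_F_U : over (eta (unit_mod b)) (mfU l) (idm munit) (fwd F_U).
Proof.
have := over_comp (lift_isoP fg eta (mfU l))
  (over_eta eta (fwd (@riso _ _ (unit_mod b) U (iso_id _) mf_U_linear))).
by rewrite /over comp1m.
Qed.

(** As [F_T] and [F_U] lie over identities, [over_eq] reduces each axiom to a trivial equation
    between structure morphisms of [C]. *)
Definition transported_monoidal : @monoidal (Rep_moncat b) B F.
Proof.
apply: (@Monoidal (Rep_moncat b) B F F_T F_U).
- move=> X X' Y Y' f g.
  have H1 := over_comp (over_F_T X' Y') (over_eta eta (tens_modm b f g)).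
  have H2 := over_comp (over_tens (over_eta eta f) (over_eta eta g)) (over_F_T X Y).
  apply: (over_eq fg eta H1 H2).
  by rewrite comp1m compm1.
- move=> X Y Z.
  apply: (over_eq fg eta (over_comp (over_comp (over_assoc (eta X) (eta Y) (eta Z))
       (over_tens (over_F_T X Y) (over_id (eta Z)))) (over_F_T (tens_mod b X Y) Z))
    (over_comp (over_comp (over_tens (over_id (eta X)) (over_F_T Y Z))
       (over_F_T X (tens_mod b Y Z)))
       (over_eta eta (fwd (@assoc (Rep_moncat b) X Y Z))))).
  by rewrite !tensm1 !compm1 !comp1m.
- move=> X.
  apply: (over_eq fg eta (over_comp (over_comp (over_lunit (eta X))
       (over_tens over_F_U (over_id (eta X)))) (over_F_T (unit_mod b) X))
       (over_eta eta (fwd (@lunit (Rep_moncat b) X)))).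
  by rewrite tensm1 !compm1.
- move=> X.
  apply: (over_eq fg eta (over_comp (over_comp (over_runit (eta X))
       (over_tens (over_id (eta X)) over_F_U)) (over_F_T X (unit_mod b)))
       (over_eta eta (fwd (@runit (Rep_moncat b) X)))).
  by rewrite tensm1 !compm1.
Qed.

End TensorStructure.

(** * Duals *)

Section Duals.
Variable C : moncat.
Local Notation O := (@WO C).

Lemma gen_isoK (X Y t : C) (i : iso X Y) :
  gen (a := O Y) (b := O X) (bwd i) t ∘ gen (a := O X) (b := O Y) (fwd i) t =
  idm (X ⊗ t).
Proof. by have H := fwdK i; flatten_in C H t. Qed.

Lemma dual_iso_l (Y Y' X : C) (i : iso Y Y') : is_dual Y X -> is_dual Y' X.
Proof.
move=> [ev [coev [Z1 Z2]]].
exists (ev ∘ (bwd i ⊠ idm X)), ((idm X ⊠ fwd i) ∘ coev); split.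
  flatten C; flatten_in C Z1 t => {}Z1.
  rewrite tens1M ?compA.
  by rewrite (pre2 (id_tensM X (gen_isoK _ i))) tensm1 compm1.
flatten C; flatten_in C Z2 t => {}Z2; rewrite tens1M ?compA.
rewrite (pre2 (gen_nat11 _ (bwd i))) ?compA gen_nat20.
rewrite (pre2 (gen_nat11 _ (bwd i))) ?compA (pre2 Z2) compm1.
exact: (gen_isoK t (iso_inv i)).
Qed.

Lemma dual_iso_r (Y X X' : C) (i : iso X X') : is_dual Y X -> is_dual Y X'.
Proof.
move=> [ev [coev [Z1 Z2]]].
exists (ev ∘ (idm Y ⊠ bwd i)), ((fwd i ⊠ idm Y) ∘ coev); split.
  flatten C; flatten_in C Z1 t => {}Z1; rewrite tens1M ?compA.
  rewrite (pre2 (esym (gen_nat11 _ (fwd i)))) ?compA -gen_nat11.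
  rewrite (pre2 (esym (gen_nat02 _ _))) ?compA (pre2 Z1) compm1.
  exact: (gen_isoK t (iso_inv i)).
flatten C; flatten_in C Z2 t => {}Z2; rewrite tens1M ?compA.
by rewrite (pre2 (id_tensM Y (gen_isoK _ i))) tensm1 compm1.
Qed.

End Duals.

(** * Reflection of duals along fully faithful monoidal functors *)

Section ReflectDuals.
Variables (C D : moncat) (F : functor C D) (Fm : monoidal F).
Hypothesis F_faithful : forall (X Y : C) (f g : hom X Y),
  fmap F f = fmap F g -> f = g.
Hypothesis F_full : forall (X Y : C) (g : hom (F X) (F Y)),
  exists f : hom X Y, fmap F f = g.

(** Fullness gives preimages of [ev] and [coev] conjugated with the monoidal structure, and
    faithfulness reflects the zigzag identities. *)
Lemma dual_reflect (Y X : C) : is_dual (F Y) (F X) -> is_dual Y X.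
Proof.
move=> [ev [coev [Z1 Z2]]].
have {}Z1 : fwd (runit (F X)) ∘ (idm (F X) ⊠ ev) ∘ fwd (assoc (F X) (F Y) (F X))
    ∘ (coev ⊠ idm (F X)) = fwd (lunit (F X)).
  by apply: (fwd_injr (i := iso_inv (lunit (F X)))); rewrite /= Z1 bwdK.
have {}Z2 : fwd (lunit (F Y)) ∘ (ev ⊠ idm (F Y)) ∘ bwd (assoc (F Y) (F X) (F Y))
    ∘ (idm (F Y) ⊠ coev) = fwd (runit (F Y)).
  by apply: (fwd_injr (i := iso_inv (runit (F Y)))); rewrite /= Z2 bwdK.
have [ev0 Eev] := F_full (bwd (mf_U Fm) ∘ ev ∘ fwd (mf_T Fm Y X)).
have [coev0 Ecoev] := F_full (bwd (mf_T Fm X Y) ∘ coev ∘ fwd (mf_U Fm)).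
have {}Eev : fwd (mf_U Fm) ∘ fmap F ev0 = ev ∘ fwd (mf_T Fm Y X).
  by rewrite Eev !compA bwdK comp1m.
have {}Ecoev : fwd (mf_T Fm X Y) ∘ fmap F coev0 = coev ∘ fwd (mf_U Fm).
  by rewrite Ecoev !compA bwdK comp1m.
have Tr (V W W' : C) (g : hom W W') : fwd (mf_T Fm V W') ∘ fmap F (idm V ⊠ g) =
    (idm (F V) ⊠ fmap F g) ∘ fwd (mf_T Fm V W).
  by rewrite mf_T_nat fmap1.
have Tl (V W W' : C) (g : hom W W') : fwd (mf_T Fm W' V) ∘ fmap F (g ⊠ idm V) =
    (fmap F g ⊠ idm (F V)) ∘ fwd (mf_T Fm W V).
  by rewrite mf_T_nat fmap1.
exists ev0, coev0; split.
  apply: (fwd_injr (i := lunit X)); rewrite -compA fwdK compm1 comp1m.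
  apply: F_faithful; rewrite !fmapM -(mf_runit Fm) -(mf_lunit Fm).
  rewrite (pre2 (Tr _ _ _ _)) ?compA (pre2 (esym (tens1M _ _ _))) Eev tens1M ?compA.
  have A := mf_assoc Fm X Y X; rewrite (pre3 (esym A)) ?compA.
  rewrite (pre2 (Tl _ _ _ _)) ?compA (pre2 (esym (tensM1 _ _ _))) Ecoev tensM1.
  by rewrite ?compA Z1.
apply: (fwd_injr (i := runit Y)); rewrite -compA fwdK compm1 comp1m.
apply: F_faithful; rewrite !fmapM -(mf_runit Fm) -(mf_lunit Fm).
rewrite (pre2 (Tl _ _ _ _)) ?compA (pre2 (esym (tensM1 _ _ _))) Eev tensM1 ?compA.
(* The axiom [mf_assoc] solved for the inverse associators of the second zigzag. *)
have A : (fwd (mf_T Fm Y X) ⊠ idm (F Y)) ∘ fwd (mf_T Fm (Y ⊗ X) Y) ∘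
    fmap F (bwd (assoc Y X Y)) =
  bwd (assoc (F Y) (F X) (F Y)) ∘
    ((idm (F Y) ⊠ fwd (mf_T Fm X Y)) ∘ fwd (mf_T Fm Y (X ⊗ Y))).
  apply: (fwd_inj (i := assoc (F Y) (F X) (F Y))); rewrite !compA bwdK comp1m mf_assoc.
  by rewrite -!compA -fmapM bwdK fmap1 compm1.
rewrite (pre3 A) ?compA (pre2 (Tr _ _ _ _)) ?compA (pre2 (esym (tens1M _ _ _))).
by rewrite Ecoev tens1M ?compA Z2.
Qed.

Lemma rigid_reflect : rigid D ->
  (forall Y : D, exists X : C, inhabited (iso Y (F X))) -> rigid C.
Proof.
move=> rD F_surj X; have [[Y YX] [Z ZX]] := rD (F X).
have [Y' [i]] := F_surj Y; have [Z' [j]] := F_surj Z.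
split; [exists Y' | exists Z']; apply: dual_reflect.
  exact: dual_iso_l YX.
exact: dual_iso_r ZX.
Qed.

End ReflectDuals.

(** * The antipode *)

Lemma pre4 (C : preadditive) (X1 X2 X3 X4 Z W : C) (f : hom X4 Z) (g : hom X3 X4)
    (h : hom X2 X3) (k : hom X1 X2) (r : hom X1 Z) :
  f ∘ g ∘ h ∘ k = r -> forall x : hom Z W, x ∘ f ∘ g ∘ h ∘ k = x ∘ r.
Proof. by move=> <- x; rewrite !compA. Qed.

Section Antipode.
Variables (C : moncat) (c : braiding C) (A : algebra C) (b : bialgebra c A).
Local Notation n := (al_ob A).
Local Notation O := (@WO C).
Local Notation c_ := (gbr c).
Local Notation D := (bi_comul b).
Local Notation e := (bi_counit b).
Local Notation R := (regular A).
Local Notation g01 f := (@gen C (@WI C) (O _) f).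
Local Notation g10 f := (@gen C (O _) (@WI C) f).
Local Notation g11 f := (@gen C (O _) (O _) f).
Local Notation g12 f := (@gen C (O _) (WT (O _) (O _)) f).
Local Notation g21 f := (@gen C (WT (O _) (O _)) (O _) f).
Local Notation g20 f := (@gen C (WT (O _) (O _)) (@WI C) f).
Local Notation g02 f := (@gen C (@WI C) (WT (O _) (O _)) f).
Local Notation gm := (g21 (al_mul A)).
Local Notation gu := (g01 (al_one A)).
Local Notation gD := (g12 D).
Local Notation ge := (g10 e).
Local Notation gact X := (g21 (mod_act X)).

Let gaA (X : Rep A) t :
  gact X t ∘ gm (mod_ob X ⊗ t) = gact X t ∘ (idm n ⊠ gact X t).
Proof. by have H := mod_assoc X; flatten_in C H t. Qed.
Let gau (X : Rep A) t : gact X t ∘ gu (mod_ob X ⊗ t) = idm (mod_ob X ⊗ t).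
Proof. by have H := mod_lunit X; flatten_in C H t. Qed.
Let gmu t : gm t ∘ (idm n ⊠ gu t) = idm (n ⊗ t).
Proof. by have H := al_runit A; flatten_in C H t. Qed.
Let gDA t : gD (n ⊗ t) ∘ gD t = (idm n ⊠ gD t) ∘ gD t.
Proof. by have H := bi_coassoc b; flatten_in C H t. Qed.
Let geDl t : ge (n ⊗ t) ∘ gD t = idm (n ⊗ t).
Proof. by have H := bi_counitl b; flatten_in C H t. Qed.
Let geDr t : (idm n ⊠ ge t) ∘ gD t = idm (n ⊗ t).
Proof. by have H := bi_counitr b; flatten_in C H t. Qed.
Let cND (X : C) t : (idm X ⊠ gD t) ∘ c_ n X t =
  c_ n X (n ⊗ t) ∘ (idm n ⊠ c_ n X t) ∘ gD (X ⊗ t).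
Proof.
have H := br_nat c D (idm X).
by flatten_in C H t => <-; rewrite gen_br2 ?compA.
Qed.
Let cNe (X : C) t : (idm X ⊠ ge t) ∘ c_ n X t = ge (X ⊗ t).
Proof.
have H := br_nat c e (idm X).
by flatten_in C H t => <-; rewrite gen_Ibr comp1m.
Qed.
Let cNa (X : C) (M : Rep A) t : c_ X (mod_ob M) t ∘ (idm X ⊠ gact M t) =
  gact M (X ⊗ t) ∘ (idm n ⊠ c_ X (mod_ob M) t) ∘ c_ X n (mod_ob M ⊗ t).
Proof.
have H := br_nat c (idm X) (mod_act M).
by flatten_in C H t; rewrite gen_br1 ?compA.
Qed.
Let cN11 (X : C) (f : hom n n) t :
  c_ n X t ∘ g11 f (X ⊗ t) = (idm X ⊠ g11 f t) ∘ c_ n X t.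
Proof. by have H := br_nat c f (idm X); flatten_in C H t. Qed.

(** In elements [<h_1 x, h_2 y> = e(h) <x, y>]: [ev] is a morphism to the unit module. *)
Definition pairing_linear (X Y : Rep A) (ev : hom (mod_ob X ⊗ mod_ob Y) munit) :=
  ev ∘ tens_act b X Y = fwd (runit munit) ∘ (e ⊠ idm munit) ∘ (idm n ⊠ ev).
Definition copairing_linear (X Y : Rep A) (coev : hom munit (mod_ob X ⊗ mod_ob Y)) :=
  coev ∘ (fwd (runit munit) ∘ (e ⊠ idm munit)) = tens_act b X Y ∘ (idm n ⊠ coev).

Lemma gen_pairing_linear (X Y : Rep A) ev t : @pairing_linear X Y ev ->
  g20 ev t ∘ gact X (mod_ob Y ⊗ t) ∘ (idm n ⊠ (idm (mod_ob X) ⊠ gact Y t)) ∘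
    (idm n ⊠ c_ n (mod_ob X) (mod_ob Y ⊗ t)) ∘ gD (mod_ob X ⊗ (mod_ob Y ⊗ t)) =
  g20 ev t ∘ ge _.
Proof.
rewrite /pairing_linear /tens_act /mid4 => H.
by flatten_in C H t; rewrite ?tens1M ?compA => ->; rewrite gen_nat10.
Qed.
Lemma gen_copairing_linear (X Y : Rep A) coev t : @copairing_linear X Y coev ->
  gact X (mod_ob Y ⊗ t) ∘ (idm n ⊠ (idm (mod_ob X) ⊠ gact Y t)) ∘
    (idm n ⊠ c_ n (mod_ob X) (mod_ob Y ⊗ t)) ∘ gD (mod_ob X ⊗ (mod_ob Y ⊗ t)) ∘
    (idm n ⊠ g02 coev t) =
  g02 coev t ∘ ge _.
Proof.
rewrite /copairing_linear /tens_act /mid4 => H.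
by flatten_in C H t; rewrite ?tens1M ?compA => ->.
Qed.

Section RightConvolution.
Variables (S : hom n n).
Hypothesis convS : al_mul A ∘ (idm n ⊠ S) ∘ D = al_one A ∘ e.

Let gconv t : gm t ∘ (idm n ⊠ g11 S t) ∘ gD t = gu t ∘ ge t.
Proof. by have H := convS; flatten_in C H t. Qed.

(* [<h f, x> = <f, S h x>], because both sides are
   [<h_1 f, h_2 (S h_3) x>]. *)
Lemma antipode_pairing (X Y : Rep A) ev t : @pairing_linear Y X ev ->
  g20 ev t ∘ gact Y (mod_ob X ⊗ t) =
  g20 ev t ∘ (idm (mod_ob Y) ⊠ gact X t) ∘ (idm (mod_ob Y) ⊠ g11 S (mod_ob X ⊗ t))
   ∘ c_ n (mod_ob Y) (mod_ob X ⊗ t).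
Proof.
move=> /(@gen_pairing_linear _ _ _ t) L.
pose h : hom (n ⊗ (mod_ob X ⊗ t)) (mod_ob X ⊗ t) :=
  gact X t ∘ g11 S (mod_ob X ⊗ t).
(* In elements [h_1 (S h_2) x = e(h) x]. *)
have hE : gact X t ∘ (idm n ⊠ h) ∘ gD (mod_ob X ⊗ t) = ge (mod_ob X ⊗ t).
  rewrite tens1M !compA -gaA -2!compA [gm _ ∘ _]compA gconv.
  by rewrite compA gau comp1m.
have -> : g20 ev t ∘ (idm (mod_ob Y) ⊠ gact X t) ∘
    (idm (mod_ob Y) ⊠ g11 S (mod_ob X ⊗ t)) = g20 ev t ∘ (idm (mod_ob Y) ⊠ h).
  by rewrite tens1M compA.
pose W := g20 ev t ∘ gact Y (mod_ob X ⊗ t) ∘ (idm n ⊠ (idm (mod_ob Y) ⊠ gact X t)) ∘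
    (idm n ⊠ c_ n (mod_ob Y) (mod_ob X ⊗ t)) ∘ gD (mod_ob Y ⊗ (mod_ob X ⊗ t)) ∘
    (idm n ⊠ (idm (mod_ob Y) ⊠ h)) ∘ (idm n ⊠ c_ n (mod_ob Y) (mod_ob X ⊗ t)) ∘
    gD (mod_ob Y ⊗ (mod_ob X ⊗ t)).
(* In [W] linearity of [ev] contracts [h_1] and [h_2], which gives the right side; coassociativity
   and [hE] contract [h_2] and [h_3], which gives the left side. *)
transitivity W; last first.
  rewrite /W L (pre2 (gen_nat10 _ e)) ?compA (pre2 (gen_nat10 _ e)) ?compA.
  by rewrite (pre2 (geDl _)) compm1.
rewrite /W {W L}; symmetry.
rewrite (pre2 (gen_nat12 _ D)) ?compA (pre2 (gen_nat12 _ D)) ?compA.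
rewrite (pre2 (gDA _)) ?compA (pre2 (id_tensM n (gbr_nat c n (mod_ob Y) h))).
rewrite tens1M ?compA.
have E : (idm n ⊠ c_ n (mod_ob Y) (n ⊗ (mod_ob X ⊗ t))) ∘
    (idm n ⊠ (idm n ⊠ c_ n (mod_ob Y) (mod_ob X ⊗ t))) ∘ (idm n ⊠ gD _) =
  (idm n ⊠ (idm (mod_ob Y) ⊠ gD (mod_ob X ⊗ t))) ∘
    (idm n ⊠ c_ n (mod_ob Y) (mod_ob X ⊗ t)).
  by rewrite -!tens1M -cND.
rewrite (pre3 E) ?compA.
have E2 : (idm n ⊠ (idm (mod_ob Y) ⊠ gact X t)) ∘
    (idm n ⊠ (idm (mod_ob Y) ⊠ (idm n ⊠ h))) ∘
    (idm n ⊠ (idm (mod_ob Y) ⊠ gD (mod_ob X ⊗ t))) =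
    idm n ⊠ (idm (mod_ob Y) ⊠ ge (mod_ob X ⊗ t)).
  by rewrite -!tens1M hE.
rewrite (pre3 E2) ?compA (pre2 (id_tensM n (cNe _ _))).
by rewrite (pre2 (geDr _)) compm1.
Qed.
End RightConvolution.
Local Notation gci := (@gen C (WT (O n) (O n)) (WT (O n) (O n)) (bwd (c n n))).

Let gcK t : c_ n n t ∘ gci t = idm (n ⊗ (n ⊗ t)).
Proof. by have H := bwdK (c n n); flatten_in C H t. Qed.
Let gciK t : gci t ∘ c_ n n t = idm (n ⊗ (n ⊗ t)).
Proof. by have H := fwdK (c n n); flatten_in C H t. Qed.
Let geci t : ge (n ⊗ t) ∘ gci t = idm n ⊠ ge t.
Proof. by rewrite -cNe -compA gcK compm1. Qed.
Let gDci t : (idm n ⊠ c_ n n t) ∘ gD (n ⊗ t) ∘ gci t =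
  gci (n ⊗ t) ∘ (idm n ⊠ gD t).
Proof.
rewrite -[LHS]comp1m -(gciK (n ⊗ t)) -!compA; congr (_ ∘ _).
have := cND n t; rewrite -!compA => /(congr1 (fun f => f ∘ gci t)).
by rewrite /= -!compA gcK compm1 => <-.
Qed.

Section SkewConvolution.
Variable S' : hom n n.
(** In elements [h_2 (S' h_1) = e(h) 1], the equation of an inverse antipode; the inverse braiding
    exchanges the factors. *)
Hypothesis convS' :
  al_mul A ∘ bwd (c n n) ∘ (S' ⊠ idm n) ∘ D = al_one A ∘ e.

Let gconv t : gm t ∘ gci t ∘ g11 S' (n ⊗ t) ∘ gD t = gu t ∘ ge t.
Proof. by have H := convS'; flatten_in C H t. Qed.

(* [<x, h f> = <S' h x, f>], because both sides are
   [<h_2 (S' h_1) x, h_3 f>]. *)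
Lemma skew_antipode_pairing (X Y : Rep A) ev t : @pairing_linear X Y ev ->
  g20 ev t ∘ (idm (mod_ob X) ⊠ gact Y t) ∘ c_ n (mod_ob X) (mod_ob Y ⊗ t) =
  g20 ev t ∘ gact X (mod_ob Y ⊗ t) ∘ g11 S' (mod_ob X ⊗ (mod_ob Y ⊗ t)).
Proof.
move=> /(@gen_pairing_linear _ _ _ t) L.
pose s := mod_ob X ⊗ (mod_ob Y ⊗ t).
pose W := g20 ev t ∘ gact X (mod_ob Y ⊗ t) ∘ (idm n ⊠ (idm (mod_ob X) ⊠ gact Y t)) ∘
    (idm n ⊠ c_ n (mod_ob X) (mod_ob Y ⊗ t)) ∘ gD s ∘
    (idm n ⊠ gact X (mod_ob Y ⊗ t)) ∘ gci s ∘ g11 S' (n ⊗ s) ∘ gD s.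
(* In [W] linearity of [ev] contracts [h_2] and [h_3], which gives the right side; [gconv] contracts
   [h_1] and [h_2], which gives the left side. *)
transitivity W; last first.
  rewrite /W L (pre2 (gen_nat10 _ e)) ?compA (pre2 (geci _)).
  by rewrite (pre2 (esym (gen_nat11 _ S'))) ?compA (pre2 (geDr _)) compm1.
rewrite /W {W L}; symmetry.
rewrite (pre2 (gen_nat12 _ D)) ?compA.
rewrite (pre2 (id_tensM n (cNa n X _))) !tens1M ?compA.
rewrite (pre3 (gDci s)) ?compA (pre2 (esym (gen_nat11 _ S'))) ?compA.
rewrite (pre2 (esym (gDA _))) ?compA.
have E : (idm n ⊠ (idm (mod_ob X) ⊠ gact Y t)) ∘
    (idm n ⊠ gact X (n ⊗ (mod_ob Y ⊗ t))) = (idm n ⊠ gact X (mod_ob Y ⊗ t)) ∘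
    (idm n ⊠ (idm n ⊠ (idm (mod_ob X) ⊠ gact Y t))).
  by rewrite -!tens1M -gen_nat21.
rewrite (pre2 E) ?compA (pre2 (esym (gaA X _))) ?compA.
rewrite (pre2 (gen_nat21 _ (al_mul A))) ?compA.
rewrite (pre2 (gen_nat21 _ (al_mul A))) ?compA.
rewrite (pre4 (gconv (n ⊗ s))) ?compA (pre2 (geDl _)) compm1.
rewrite (pre2 (esym (gen_nat01 _ _))) ?compA (pre2 (esym (gen_nat01 _ _))) ?compA.
by rewrite (pre2 (gau X _)) compm1.
Qed.
End SkewConvolution.

(** * The antipode and its inverse from the duals of the regular module *)

Section AntipodeOfDuals.
Variables Y Y' : Rep A.
Variables (ev : hom (mod_ob Y ⊗ n) munit) (coev : hom munit (n ⊗ mod_ob Y)).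
Variables (ev' : hom (n ⊗ mod_ob Y') munit) (coev' : hom munit (mod_ob Y' ⊗ n)).
Hypotheses (ev_lin : @pairing_linear Y R ev)
  (coev_lin : @copairing_linear R Y coev)
  (ev'_lin : @pairing_linear R Y' ev')
  (coev'_lin : @copairing_linear Y' R coev').
Hypothesis zig : fwd (runit n) ∘ (idm n ⊠ ev) ∘ fwd (assoc n (mod_ob Y) n) ∘
  (coev ⊠ idm n) ∘ bwd (lunit n) = idm n.
Hypothesis zag' : fwd (lunit n) ∘ (ev' ⊠ idm n) ∘
  bwd (assoc n (mod_ob Y') n) ∘ (idm n ⊠ coev') ∘ bwd (runit n) = idm n.

Let gzig t : (idm n ⊠ g20 ev t) ∘ g02 coev (n ⊗ t) = idm (n ⊗ t).
Proof. by have H := zig; flatten_in C H t. Qed.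
Let gzag' t : g20 ev' (n ⊗ t) ∘ (idm n ⊠ g02 coev' t) = idm (n ⊗ t).
Proof. by have H := zag'; flatten_in C H t. Qed.

(* [h |-> e_i <h e^i, 1>] *)
Definition antipode : hom n n :=
  fwd (runit n) ∘
  (idm n ⊠ (ev ∘ (idm (mod_ob Y) ⊠ al_one A) ∘ bwd (runit (mod_ob Y)) ∘ mod_act Y))
  ∘ fwd (assoc n n (mod_ob Y)) ∘ (fwd (c n n) ⊠ idm (mod_ob Y)) ∘
  bwd (assoc n n (mod_ob Y)) ∘ (idm n ⊠ coev) ∘ bwd (runit n).

(* [h |-> <1, h e^i> e_i] *)
Definition skew_antipode : hom n n :=
  fwd (lunit n) ∘
  ((ev' ∘ (al_one A ⊠ idm (mod_ob Y')) ∘ bwd (lunit (mod_ob Y')) ∘ mod_act Y')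
    ⊠ idm n) ∘ bwd (assoc n (mod_ob Y') n) ∘ (idm n ⊠ coev') ∘ bwd (runit n).

Lemma gen_antipode t : g11 antipode t =
  (idm n ⊠ g20 ev t) ∘ (idm n ⊠ (idm (mod_ob Y) ⊠ gu t)) ∘ (idm n ⊠ gact Y t) ∘
  c_ n n (mod_ob Y ⊗ t) ∘ (idm n ⊠ g02 coev t).
Proof.
have H : antipode = fwd (runit n) ∘
  (idm n ⊠ (ev ∘ (idm (mod_ob Y) ⊠ al_one A) ∘ bwd (runit (mod_ob Y)) ∘ mod_act Y))
  ∘ fwd (assoc n n (mod_ob Y)) ∘ (fwd (c n n) ⊠ idm (mod_ob Y)) ∘
  bwd (assoc n n (mod_ob Y)) ∘ (idm n ⊠ coev) ∘ bwd (runit n) by [].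
by flatten_in C H t => ->; rewrite !tens1M ?compA.
Qed.

Lemma gen_skew_antipode t : g11 skew_antipode t =
  g20 ev' (n ⊗ t) ∘ gu (mod_ob Y' ⊗ (n ⊗ t)) ∘ gact Y' (n ⊗ t) ∘
  (idm n ⊠ g02 coev' t).
Proof.
have H : skew_antipode = fwd (lunit n) ∘
  ((ev' ∘ (al_one A ⊠ idm (mod_ob Y')) ∘ bwd (lunit (mod_ob Y')) ∘ mod_act Y')
    ⊠ idm n) ∘ bwd (assoc n (mod_ob Y') n) ∘ (idm n ⊠ coev') ∘ bwd (runit n) by [].
by flatten_in C H t => ->.
Qed.

(** In elements [h_1 e_i <h_2 e^i, 1> = e(h) e_i <e^i, 1> = e(h) 1], by linearity of [coev] and the
    zigzag identity. *)
Lemma antipode_convr : al_mul A ∘ (idm n ⊠ antipode) ∘ D = al_one A ∘ e.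
Proof.
flatten C; rewrite gen_antipode !tens1M !compA.
rewrite (pre2 (esym (gen_nat12 _ D))) ?compA.
rewrite gen_nat21 (pre2 (gen_nat21 _ (al_mul A))) ?compA.
have L : gm (mod_ob Y ⊗ t) ∘ (idm n ⊠ (idm n ⊠ gact Y t)) ∘
    (idm n ⊠ c_ n n (mod_ob Y ⊗ t)) ∘ gD (n ⊗ (mod_ob Y ⊗ t)) ∘
    (idm n ⊠ g02 coev t) = g02 coev t ∘ ge _ := gen_copairing_linear t coev_lin.
rewrite -!compA in L *; rewrite L !compA (pre2 (esym (gen_nat02 _ coev))) ?compA.
by rewrite gzig comp1m.
Qed.

(** In elements [<1, h_1 e^i> h_2 e_i = e(h) <1, e^i> e_i = e(h) 1], by linearity of [coev'] and the
    zigzag identity. *)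
Lemma skew_antipode_conv :
  al_mul A ∘ bwd (c n n) ∘ (skew_antipode ⊠ idm n) ∘ D = al_one A ∘ e.
Proof.
(* Braiding past both factors of [coev'] is trivial, so the inverse braiding with one factor is the
   braiding with the other. *)
have E t : (idm (mod_ob Y') ⊠ gci t) ∘ g02 coev' (n ⊗ t) =
    c_ n (mod_ob Y') (n ⊗ t) ∘ (idm n ⊠ g02 coev' t).
  have H := br_nat c (idm n) coev'.
  flatten_in C H t; rewrite gen_br1 gen_brI compm1 => {}H.
  rewrite -H !compA -tens1M.
  by rewrite gciK tensm1 comp1m.
flatten C; rewrite gen_skew_antipode !compA.
pose h : hom (n ⊗ (n ⊗ t)) (n ⊗ t) := gm t ∘ gci t.
have Eh : (idm n ⊠ (idm (mod_ob Y') ⊠ h)) ∘ (idm n ⊠ g02 coev' (n ⊗ t)) =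
   (idm n ⊠ (idm (mod_ob Y') ⊠ gm t)) ∘ (idm n ⊠ c_ n (mod_ob Y') (n ⊗ t)) ∘
   (idm n ⊠ (idm n ⊠ g02 coev' t)).
  by rewrite -!tens1M -compA -E compA -tens1M.
rewrite -(gen_nat20 h ev') (pre2 (esym (gen_nat01 _ (al_one A)))) ?compA.
rewrite (pre2 (esym (gen_nat21 h (mod_act Y')))) ?compA (pre2 Eh) ?compA.
rewrite (pre2 (esym (gen_nat12 _ D))) ?compA.
have L : gact Y' (n ⊗ t) ∘ (idm n ⊠ (idm (mod_ob Y') ⊠ gm t)) ∘
    (idm n ⊠ c_ n (mod_ob Y') (n ⊗ t)) ∘ gD (mod_ob Y' ⊗ (n ⊗ t)) ∘
    (idm n ⊠ g02 coev' t) = g02 coev' t ∘ ge _ := gen_copairing_linear t coev'_lin.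
rewrite -!compA in L *; rewrite L !compA (pre2 (gen_nat01 _ _)) ?compA.
by rewrite gzag' comp1m.
Qed.

Local Notation S := antipode.
Local Notation S' := skew_antipode.

(** The pairing is nondegenerate: [gzig] recovers [f] as [e_i <e^i, f>]. *)
Let ev_cancel (X t : C) (f g : hom X (n ⊗ t)) :
  g20 ev t ∘ (idm (mod_ob Y) ⊠ f) = g20 ev t ∘ (idm (mod_ob Y) ⊠ g) -> f = g.
Proof.
have cancel h : (idm n ⊠ (g20 ev t ∘ (idm (mod_ob Y) ⊠ h))) ∘ g02 coev X = h.
  by rewrite tens1M -compA -gen_nat02 compA gzig comp1m.
by move=> E; rewrite -(cancel f) E cancel.
Qed.

Let br_cancel (X Z t W : C) (f g : hom (Z ⊗ (X ⊗ t)) W) :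
  f ∘ c_ X Z t = g ∘ c_ X Z t -> f = g.
Proof.
exact: (@gen_iso_inj C (WT (O X) (O Z)) (WT (O Z) (O X)) (c X Z) t).
Qed.

Let pairing_l t : g20 ev t ∘ gact Y (n ⊗ t) =
  g20 ev t ∘ (idm (mod_ob Y) ⊠ gm t) ∘ (idm (mod_ob Y) ⊠ g11 S (n ⊗ t)) ∘
  c_ n (mod_ob Y) (n ⊗ t) := antipode_pairing antipode_convr t ev_lin.

(** In elements [<f, (S h_1) h_2 x> = <h_1 f, h_2 x> = e(h) <f, x>]. Cancel the pairing and put
    [x = 1]. *)
Lemma antipode_convl : al_mul A ∘ (S ⊠ idm n) ∘ D = al_one A ∘ e.
Proof.
have E t : gm t ∘ g11 S (n ⊗ t) ∘ (idm n ⊠ gm t) ∘ gD (n ⊗ t) = ge (n ⊗ t).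
  apply/ev_cancel/br_cancel; rewrite !tens1M !compA.
  rewrite (pre2 (cND (mod_ob Y) (n ⊗ t))) ?compA.
  rewrite (pre2 (esym (gbr_nat c n (mod_ob Y) (gm t)))) ?compA -pairing_l.
  have L : g20 ev t ∘ gact Y (n ⊗ t) ∘ (idm n ⊠ (idm (mod_ob Y) ⊠ gm t)) ∘
    (idm n ⊠ c_ n (mod_ob Y) (n ⊗ t)) ∘ gD (mod_ob Y ⊗ (n ⊗ t)) =
    g20 ev t ∘ ge _ := gen_pairing_linear t ev_lin.
  by rewrite L -compA cNe.
flatten C; have := congr1 (fun f => f ∘ (idm n ⊠ gu t)) (E t).
rewrite /= gen_nat10 -!compA gen_nat12 (compA (idm n ⊠ gm t)) -tens1M gmu.
by rewrite tensm1 comp1m !compA.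
Qed.

(** In elements [<f, h x> = <(S' h) f, x> = <f, S (S' h) x>]. Cancel the pairing and put [x = 1]. *)
Lemma skew_antipodeK : S ∘ S' = idm n.
Proof.
have L t : g20 ev t ∘ (idm (mod_ob Y) ⊠ gm t) ∘ c_ n (mod_ob Y) (n ⊗ t) =
  g20 ev t ∘ gact Y (n ⊗ t) ∘ g11 S' (mod_ob Y ⊗ (n ⊗ t)) :=
  skew_antipode_pairing skew_antipode_conv t ev_lin.
have E t : gm t ∘ g11 S (n ⊗ t) ∘ g11 S' (n ⊗ t) = gm t.
  apply/ev_cancel/br_cancel; rewrite L pairing_l !tens1M !compA.
  by rewrite [in RHS](pre2 (cN11 _ _ _)) ?compA.
flatten C; have := congr1 (fun f => f ∘ (idm n ⊠ gu t)) (E t).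
by rewrite /= gmu (pre2 (gen_nat11 _ _)) ?compA (pre2 (gen_nat11 _ _)) ?compA gmu comp1m.
Qed.

(** The same comparison for [ev']: [<h x, f> = <x, (S h) f> = <S' (S h) x, f>]. *)
Lemma antipodeK : S' ∘ S = idm n.
Proof.
have L1 t : g20 ev' t ∘ gm (mod_ob Y' ⊗ t) =
  g20 ev' t ∘ (idm n ⊠ gact Y' t) ∘ (idm n ⊠ g11 S (mod_ob Y' ⊗ t)) ∘
  c_ n n (mod_ob Y' ⊗ t) := antipode_pairing antipode_convr t ev'_lin.
have L2 t : g20 ev' t ∘ (idm n ⊠ gact Y' t) ∘ c_ n n (mod_ob Y' ⊗ t) =
  g20 ev' t ∘ gm (mod_ob Y' ⊗ t) ∘ g11 S' (n ⊗ (mod_ob Y' ⊗ t)) :=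
  skew_antipode_pairing skew_antipode_conv t ev'_lin.
have E t : g20 ev' t ∘ gm (mod_ob Y' ⊗ t) ∘ g11 S' (n ⊗ (mod_ob Y' ⊗ t)) ∘
    g11 S (n ⊗ (mod_ob Y' ⊗ t)) = g20 ev' t ∘ gm (mod_ob Y' ⊗ t).
  rewrite -L2 [in RHS]L1.
  by rewrite (pre2 (cN11 _ _ _)) ?compA.
flatten C.
(* Inserting [coev'] cancels the pairing [ev'] by [gzag']; then [x] is set to the unit. *)
have := congr1 (fun f => f ∘ (idm n ⊠ (idm n ⊠ g02 coev' t))) (E (n ⊗ t)).
rewrite /= (pre2 (gen_nat11 _ S)) ?compA (pre2 (gen_nat11 _ S')) ?compA.
rewrite !(pre2 (gen_nat21 _ (al_mul A))) ?compA gzag' !comp1m.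
move=> /(congr1 (fun f => f ∘ (idm n ⊠ gu t))).
by rewrite /= (pre2 (gen_nat11 _ S)) ?compA (pre2 (gen_nat11 _ S')) ?compA gmu comp1m.
Qed.

Definition rec_hopf : hopf_algebra c A :=
  @HopfAlgebra C c A b (Iso antipodeK skew_antipodeK)
    antipode_convl antipode_convr.

End AntipodeOfDuals.

(** The equation [ha_bi h = b] lets a tensor structure on a functor from the modules over [b] be
    used for [h]. *)
Lemma hopf_of_rigid : rigid (Rep_moncat b) ->
  exists h : hopf_algebra c A, ha_bi h = b.
Proof.
move=> rRep; have [[Y [ev [coev [zig _]]]] [Y' [ev' [coev' [_ zag']]]]] := rRep R.
exists (@rec_hopf Y Y' (rval ev) (rval coev) (rval ev') (rval coev')
  (rvalE ev) (rvalE coev) (rvalE ev') (rvalE coev')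
  (congr1 (@rval _ _ _ _) zig) (congr1 (@rval _ _ _ _) zag')).
by [].
Qed.

End Antipode.

(** * The tensor equivalence *)

Theorem lemma4p12
  (C B : tensorcat) (c : braiding C)
  (* The braided functor [(iota, c')] to the center; [iota] is
     [center_forget J] and [c'_{V,N}] is [ce_hb (J V) N]. *)
  (J : monfunctor C (center B))
  (J_braided : is_braided (rev_braiding c) (center_braiding B) J)
  (l : monfunctor B C)
  (theta : monnatiso (monfunctor_comp l (center_forget J)) (monfunctor_id C))
  (l_half_braiding : forall (V : C) (N : B),
     (idm (l N) ⊠ fwd (theta V)) ∘ fwd (mfT l N (center_forget J V))
       ∘ fmap l (fwd (ce_hb (J V) N)) =
     bwd (c (l N) V) ∘ (fwd (theta V) ⊠ idm (l N))
       ∘ fwd (mfT l (center_forget J V) N))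
  (A : algebra C)
  (F : functor (Rep A) B)
  (F_equiv : is_equivalence F)
  (eta : natiso (functor_comp l F) (forget A))
  (FT : @module_functor C (Rep_rmod A) (res_rmod (center_forget J)) F)
  (l_FT : forall (M : Rep_rmod A) (V : C),
     (fwd (eta M) ⊠ fwd (theta V)) ∘ fwd (mfT l (F M) (center_forget J V))
       ∘ fmap l (fwd (mo_T FT M V)) =
     fwd (forget_T M V) ∘ fwd (eta (ract M V))) :
  (exists b : bialgebra c A, @tensor_equivalence (Rep_tensorcat b) B F) /\
  (rigid C -> rigid B ->
   exists h : hopf_algebra c A,
     rigid (Rep_tensorcat h) /\ @tensor_equivalence (Rep_tensorcat h) B F).
Proof.
have [G [[gf] [fg]]] := F_equiv.
pose b := transported_bialgebra l_half_braiding gf fg l_FT.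
have Fm : @monoidal (Rep_moncat b) B F.
  exact: (transported_monoidal l_half_braiding gf fg l_FT).
split; first by exists b; split; [exact: F_equiv | constructor].
move=> _ rB.
have rRep : rigid (Rep_moncat b).
  (* Rigidity is reflected along the tensor equivalence [F]; essential surjectivity holds because
     [fg] identifies [Y] with [F (G Y)]. *)
  apply: (rigid_reflect Fm _ _ rB) => [X Y f g|X Y g|Y].
  - exact: retract_faithful gf _ _ f g.
  - exact: equivalence_full gf fg X Y g.
  - by exists (G Y); split; exact: iso_inv (fg Y).
have [h hb] := hopf_of_rigid rRep.
exists h; rewrite hb; split; first exact: rRep.
by split; [exact: F_equiv | constructor].
Qed.
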